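(* Let $\boldsymbol{A}\in\mathcal{DM}_{\rm loc}(\Omega)$ and let $E\Subset\Omega$ be a Borel set. If $\chi_E\in BV^{\boldsymbol{A},\lambda}(\Omega)$ for some Borel function $\lambda:\Omega\to[0,1]$, then $$\mathrm{div}\boldsymbol{A}(E^1)+\int_{\partial^*E}\lambda\,d\,\mathrm{div}\boldsymbol{A}=-\int_{\partial^-E}d(\boldsymbol{A},D\chi_E)_\lambda.$$ If $\chi_E\in BV^{\boldsymbol{A},0}(\Omega)$, then $$\mathrm{div}\boldsymbol{A}(E^1)=-\int_{\partial^-E}d(\boldsymbol{A},D\chi_E)_0;$$ if instead $\chi_E\in BV^{\boldsymbol{A},1}(\Omega)$, then $$\mathrm{div}\boldsymbol{A}(E^1\cup\partial^*E)=-\int_{\partial^-E}d(\boldsymbol{A},D\chi_E)_1.$$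
   Context: $\Omega\subset\mathbb{R}^N$ is a nonempty open set; $\mathscr{L}^N$ is Lebesgue measure; $\mathcal{M}(\Omega)$, $\mathcal{M}_{\rm loc}(\Omega)$ are the finite, respectively locally finite, (signed) Radon measures on $\Omega$, $\mathcal{M}_{\rm loc}(\Omega;\mathbb{R}^N)$ the vector-valued version. $E\Subset\Omega$ means that $\overline E$ is bounded and $\overline E\subset\Omega$. $\mathcal{DM}_{\rm loc}(\Omega)$ is the set of $\boldsymbol{A}\in\mathcal{M}_{\rm loc}(\Omega;\mathbb{R}^N)$ with distributional divergence $\mathrm{div}\boldsymbol{A}\in\mathcal{M}_{\rm loc}(\Omega)$. For a Borel set $E$: $E^1$ is the set of points of Lebesgue density $1$ of $E$, $\partial^*E:=\mathbb{R}^N\setminus(E^1\cup(\mathbb{R}^N\setminus E)^1)$, $\partial^-E:=\{x\in\mathbb{R}^N:0<\mathscr{L}^N(E\cap B_r(x))<\mathscr{L}^N(B_r(x))\ \forall r>0\}$. The $\lambda$-representative of $\chi_E$ is $\chi_E^\lambda=\chi_{E^1}+\lambda\chi_{\partial^*E}$ (so $\chi_E^0=\chi_{E^1}$, $\chi_E^1=\chi_{E^1\cup\partial^*E}$ for $\lambda\equiv0,1$), and the $\lambda$-pairing is the distribution $$\langle(\boldsymbol{A},D\chi_E)_\lambda,\varphi\rangle:=-\int_\Omega\chi_E^\lambda\varphi\,d\,\mathrm{div}\boldsymbol{A}-\int_\Omega\chi_E^\lambda\nabla\varphi\cdot d\boldsymbol{A},\qquad\varphi\in C_c^\infty(\Omega);$$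 subscripts $0$, $1$ refer to $\lambda\equiv0$, $\lambda\equiv1$. $\chi_E\in BV^{\boldsymbol{A},\lambda}(\Omega)$ means $\chi_E^\lambda\in L^1(\Omega,|\boldsymbol{A}|)\cap L^1(\Omega,|\mathrm{div}\boldsymbol{A}|)$ and $(\boldsymbol{A},D\chi_E)_\lambda\in\mathcal{M}(\Omega)$. *)

(* Defs.v *)
From HB Require Import structures.
From mathcomp Require Import all_boot all_order all_algebra.
From mathcomp Require Import all_classical all_reals all_analysis.

Set Implicit Arguments.
Unset Strict Implicit.
Unset Printing Implicit Defensive.
Import Order.TTheory GRing.Theory Num.Theory.
Import numFieldNormedType.Exports.

Local Open Scope classical_set_scope.
Local Open Scope ring_scope.

Definition borelRn (R : realType) (N : nat) :=
  g_sigma_algebraType (@open 'rV[R]_N).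

(* The library norm on ['rV[R]_N] is the sup norm; balls below are Euclidean. *)
Definition enorm (R : realType) (N : nat) (x : 'rV[R]_N) : R :=
  Num.sqrt (\sum_(i < N) x 0 i ^+ 2).

Definition eball (R : realType) (N : nat) (x : 'rV[R]_N) (r : R) :
    set 'rV[R]_N :=
  [set y | enorm (y - x) < r].

(* N-dimensional Lebesgue measure of a Borel set, as the N-fold product of the
   one-dimensional one: the measure of [A] is the integral over the first
   coordinate of the measures of the sections of [A]. *)
Fixpoint lebesgueN (R : realType) (N : nat) : set 'rV[R]_N -> \bar R :=
  match N with
  | 0 => fun A => (\1_A 0)%:E
  | n.+1 => fun A =>
      (\int[@lebesgue_measure R]_(t in setT)
         @lebesgueN R n
           [set y : 'rV[R]_n | A (row_mx (const_mx t : 'rV[R]_1) y)])%E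
  end.

(* [cin E Om] is E ⋐ Om. *)
Definition cin (R : realType) (N : nat) (E Om : set 'rV[R]_N) : Prop :=
  bounded_set (closure E) /\ closure E `<=` Om.

(* Locally finite Radon measures on [Om] with values in [V]: set functions on
   the Borel sets B ⋐ Om, countably additive as long as the union is ⋐ Om.
   Values on other sets are irrelevant. *)
Definition Mloc (R : realType) (N : nat) (V : normedModType R)
    (Om : set 'rV[R]_N) (nu : set 'rV[R]_N -> V) : Prop :=
  forall F : nat -> set (borelRn R N),
    (forall k, measurable (F k)) -> trivIset setT F ->
    cin (\bigcup_k F k) Om ->
    (fun n => \sum_(k < n) nu (F k)) @ \oo --> nu (\bigcup_k F k).

(* |nu|(B `&` Om), for [g] the map B |-> |nu(B)|. *)
Definition totvar (R : realType) (N : nat) (Om : set 'rV[R]_N)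
    (g : set 'rV[R]_N -> R) (B : set (borelRn R N)) : \bar R :=
  ereal_sup [set (\sum_(0 <= k <oo) (g (F k))%:E)%E |
    F in [set F : nat -> set (borelRn R N) |
           [/\ forall k, measurable (F k), forall k, cin (F k) Om,
               trivIset setT F & \bigcup_k F k `<=` B]]].

(* Positive part of the Jordan decomposition of a real Radon measure on [Om],
   nu^+(B `&` Om) = sup { nu(F) : F Borel, F ⊂ B, F ⋐ Om }. *)
Definition posvar (R : realType) (N : nat) (Om : set 'rV[R]_N)
    (nu : set 'rV[R]_N -> R) (B : set (borelRn R N)) : \bar R :=
  ereal_sup [set (nu F)%:E |
    F in [set F : set (borelRn R N) |
           [/\ measurable F, F `<=` B & cin F Om]]].

Definition negvar (R : realType) (N : nat) (Om : set 'rV[R]_N)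
    (nu : set 'rV[R]_N -> R) : set (borelRn R N) -> \bar R :=
  posvar Om (fun B => - nu B).

(* ∫_D f dnu for a real Radon measure [nu] on [Om], D ⊂ Om and f integrable on D
   with respect to |nu|. *)
Definition sint (R : realType) (N : nat) (Om : set 'rV[R]_N)
    (nu : set 'rV[R]_N -> R) (D : set 'rV[R]_N) (f : 'rV[R]_N -> R) : R :=
  fine (\int[posvar Om nu]_(x in D) (f x)%:E)%E -
  fine (\int[negvar Om nu]_(x in D) (f x)%:E)%E.

Definition partial (R : realType) (N : nat) (i : 'I_N) (f : 'rV[R]_N -> R) :
    'rV[R]_N -> R :=
  fun x => 'D_(delta_mx 0 i) f x.

(* C^\infty: all iterated partial derivatives exist and are continuous. *)
Definition smooth (R : realType) (N : nat) (f : 'rV[R]_N -> R) : Prop :=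
  forall s : seq 'I_N,
    let g := foldr (@partial R N) f s in
    continuous g /\ forall x i, derivable g x (delta_mx 0 i).

(* C_c^\infty(Om), its elements being extended by 0 outside [Om]. *)
Definition testfun (R : realType) (N : nat) (Om : set 'rV[R]_N)
    (phi : 'rV[R]_N -> R) : Prop :=
  let supp := closure [set x | phi x != 0] in
  [/\ smooth phi, compact supp & supp `<=` Om].

(* ∫_Om h ∇phi · dA *)
Definition grad_int (R : realType) (N : nat) (Om : set 'rV[R]_N)
    (A : set 'rV[R]_N -> 'rV[R]_N) (h phi : 'rV[R]_N -> R) : R :=
  \sum_(i < N) sint Om (fun B => A B 0 i) Om (fun x => h x * partial i phi x).

Definition is_divergence (R : realType) (N : nat) (Om : set 'rV[R]_N)
    (A : set 'rV[R]_N -> 'rV[R]_N) (dA : set 'rV[R]_N -> R) : Prop :=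
  Mloc Om (dA : set 'rV[R]_N -> R^o) /\
  forall phi, testfun Om phi ->
    sint Om dA Om phi = - grad_int Om A (cst 1) phi.

Definition DMloc (R : realType) (N : nat) (Om : set 'rV[R]_N)
    (A : set 'rV[R]_N -> 'rV[R]_N) : Prop :=
  Mloc Om A /\ exists dA, is_divergence Om A dA.

(* E^1 *)
Definition density1 (R : realType) (N : nat) (E : set 'rV[R]_N) :
    set 'rV[R]_N :=
  [set x | (fun r : R => fine (lebesgueN (E `&` eball x r)) /
                         fine (lebesgueN (eball x r))) @ 0^'+ --> (1 : R)].

(* ∂^*E *)
Definition essbd (R : realType) (N : nat) (E : set 'rV[R]_N) :
    set 'rV[R]_N :=
  ~` (density1 E `|` density1 (~` E)).

(* ∂^-E *)
Definition measbd (R : realType) (N : nat) (E : set 'rV[R]_N) :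
    set 'rV[R]_N :=
  [set x | forall r : R, 0 < r ->
     (0 < lebesgueN (E `&` eball x r) < lebesgueN (eball x r))%E].

(* χ_E^λ *)
Definition chirep (R : realType) (N : nat) (lam : 'rV[R]_N -> R)
    (E : set 'rV[R]_N) : 'rV[R]_N -> R :=
  fun x => \1_(density1 E) x + lam x * \1_(essbd E) x.

Definition pairing (R : realType) (N : nat) (Om : set 'rV[R]_N)
    (A : set 'rV[R]_N -> 'rV[R]_N) (dA : set 'rV[R]_N -> R)
    (lam : 'rV[R]_N -> R) (E : set 'rV[R]_N) (phi : 'rV[R]_N -> R) : R :=
  - sint Om dA Om (fun x => chirep lam E x * phi x)
  - grad_int Om A (chirep lam E) phi.

(* Finite Radon measures on [Om] are given by charges on R^N; only their values
   on subsets of [Om] matter. *)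
Definition represents (R : realType) (N : nat) (Om : set 'rV[R]_N)
    (mu : {charge set (borelRn R N) -> \bar R})
    (T : ('rV[R]_N -> R) -> R) : Prop :=
  forall phi, testfun Om phi -> T phi = sint Om (fun B => fine (mu B)) Om phi.

(* χ_E ∈ BV^{A,λ}(Om), where [dA] is the divergence of [A] *)
Definition BVlam (R : realType) (N : nat) (Om : set 'rV[R]_N)
    (A : set 'rV[R]_N -> 'rV[R]_N) (dA : set 'rV[R]_N -> R)
    (lam : 'rV[R]_N -> R) (E : set 'rV[R]_N) : Prop :=
  [/\ (totvar Om (fun B => enorm (A B))).-integrable Om
        (EFin \o (chirep lam E : borelRn R N -> R)),
      (totvar Om (fun B => `|dA B|)).-integrable Om
        (EFin \o (chirep lam E : borelRn R N -> R)) &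
      exists mu, represents Om mu (pairing Om A dA lam E)].

(* Main.v *)
(* The complement of the measure-theoretic boundary is the union of two open
   sets: the points near which E is Lebesgue-null, where the representative of
   the indicator function vanishes, and the points near which the complement of
   E is null, where it is 1. On test functions supported in the first set the
   pairing vanishes trivially, and on those supported in the second it vanishes
   by the definition of the divergence. Hence the measure mu representing the
   pairing is carried by the boundary, which lies in the closure of E. Now test
   the pairing with a cutoff function equal to 1 near the closure of E: its
   gradient does not contribute, so the pairing is minus the integral of the
   representative against div A, while mu gives the mass of the boundary. *)

Require Import Defs.
From HB Require Import structures.
From mathcomp Require Import all_boot all_order all_algebra.
From mathcomp Require Import all_classical all_reals all_analysis.
From mathcomp Require Import measurable_realfun.
From mathcomp Require Import ring.
Import Order.TTheory GRing.Theory Num.Theory.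
Import numFieldNormedType.Exports.

Local Open Scope classical_set_scope.
Local Open Scope ring_scope.

(** The costly step is to pass from [mu] annihilating the test functions of an open set to both
    variations of [mu] vanishing there, since [sint] integrates against [posvar] and [negvar]
    separately. Test functions are built explicitly from exp(-1/t), and k phi / (1 + k phi)
    increases to the indicator of the set where phi is positive. Monotone convergence then equates
    the two variations on such sets, hence on Borel subsets. Where the variations agree, their
    difference [mu] is zero, and each variation, being a supremum of values of [mu], is zero too.

    A second obstacle is that div A is only locally finite: its variations may be infinite on [Om],
    where [fine] would lose information. The sets whose mass enters the formula all lie in the
    closure of E, which is ⋐ [Om], so the Jordan decomposition is only needed on such sets. Finally,
    E^1 is defined by a limit over a continuum of radii, so that its measurability needs an argument
    of its own. *)

Section euclidean_balls.
Context {R : realType} {N : nat}.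
Implicit Types x y z : 'rV[R]_N.

Lemma enorm_ge0 x : 0 <= enorm x.
Proof. exact: sqrtr_ge0. Qed.

Lemma enorm_sqr x : enorm x ^+ 2 = \sum_(i < N) x 0 i ^+ 2.
Proof. by rewrite sqr_sqrtr// sumr_ge0// => i _; exact: sqr_ge0. Qed.

Lemma abs_coord_le_enorm x i : `|x 0 i| <= enorm x.
Proof.
rewrite -sqrtr_sqr ler_wsqrtr// (bigD1 i)//= lerDl sumr_ge0// => j _.
exact: sqr_ge0.
Qed.

Lemma ler_enormD x y : enorm (x + y) <= enorm x + enorm y.
Proof.
have key : \sum_(i < N) x 0 i * y 0 i <= enorm x * enorm y.
  have [x0|x0] := eqVneq (enorm x * enorm y) 0.
    have z0 (u : 'rV[R]_N) i : enorm u = 0 -> u 0 i = 0.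
      by move=> u0; apply/eqP; rewrite -normr_le0 (le_trans (abs_coord_le_enorm u i))// u0.
    rewrite x0 big1// => i _; move/eqP: x0.
    by rewrite mulf_eq0 => /orP[] /eqP /z0 ->; rewrite ?mul0r ?mulr0.
  have xy0 : 0 < enorm x * enorm y by rewrite lt_def x0 mulr_ge0// enorm_ge0.
  (* Cauchy-Schwarz from a sum of squares: it expands to 2|x||y| (|x||y| - x.y), and the factor
     2|x||y| is positive in this branch. *)
  have : 0 <= \sum_(i < N) (x 0 i * enorm y - y 0 i * enorm x) ^+ 2.
    by apply: sumr_ge0 => i _; exact: sqr_ge0.
  have -> : \sum_(i < N) (x 0 i * enorm y - y 0 i * enorm x) ^+ 2 =
      2 * (enorm x * enorm y) *
      (enorm x * enorm y - \sum_(i < N) x 0 i * y 0 i).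
    rewrite (eq_bigr (fun i => x 0 i ^+ 2 * enorm y ^+ 2 +
       y 0 i ^+ 2 * enorm x ^+ 2 +
       (x 0 i * y 0 i) * (- 2 * (enorm x * enorm y)))); last first.
      by move=> i _; ring.
    by rewrite !big_split/= -!mulr_suml -!enorm_sqr; ring.
  by rewrite pmulr_rge0 ?subr_ge0// mulr_gt0.
rewrite -(@ler_pXn2r _ 2)// ?nnegrE ?addr_ge0 ?enorm_ge0//.
have -> : enorm (x + y) ^+ 2 =
    enorm x ^+ 2 + enorm y ^+ 2 + (\sum_(i < N) x 0 i * y 0 i) * 2.
  rewrite !enorm_sqr mulr_suml -!big_split/=; apply: eq_bigr => i _.
  by rewrite mxE; ring.
rewrite sqrrD [leRHS]addrAC lerD2l mulr_natr lerMn2r.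
by rewrite key orbT.
Qed.

Lemma continuous_sum_fun (T : topologicalType) (I : Type) (r : seq I)
    (f : I -> T -> R) :
  (forall i, continuous (f i)) -> continuous (fun t => \sum_(i <- r) f i t).
Proof.
move=> cf; elim: r => [|i r IH].
  by under eq_fun do rewrite big_nil; exact: cst_continuous.
under eq_fun do rewrite big_cons.
by move=> t; apply: cvgD; [exact: cf|exact: IH].
Qed.

Lemma continuous_enorm : continuous (@enorm R N).
Proof.
move=> x; apply: (@continuous_comp _ _ _ (fun x => \sum_(i < N) x 0 i ^+ 2) Num.sqrt).
  apply: continuous_sum_fun => i {}x.
  apply: (@continuous_comp _ _ _ (fun x : 'rV[R]_N => x 0 i) (fun t => t ^+ 2)).
    exact: coord_continuous.
  exact: exprn_continuous.
exact: sqrt_continuous.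
Qed.

Lemma open_eball x r : open (eball x r).
Proof.
rewrite (_ : eball x r = (fun y => enorm (y - x)) @^-1` [set t | t < r])//.
apply: open_comp; last exact: open_lt.
move=> y _; apply: (@continuous_comp _ _ _ (fun y => y - x) (@enorm R N)).
  by apply: continuousB; [exact: cvg_id|exact: cst_continuous].
exact: continuous_enorm.
Qed.

Lemma eball_center x r : 0 < r -> eball x r x.
Proof.
move=> r0; rewrite /eball/= subrr /enorm big1 ?sqrtr0// => i _.
by rewrite mxE expr0n.
Qed.

Lemma eball_sub_ball x r : 0 < r -> eball x r `<=` ball x r.
Proof.
move=> r0 y; rewrite /eball/= => xy; split=> // i j.
rewrite (ord1 i) -ball_normE /ball_/= distrC.
by have := abs_coord_le_enorm (y - x) j; rewrite !mxE => /le_lt_trans; apply.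
Qed.

Lemma eball_shift x y r s : enorm (x - y) <= s -> eball x r `<=` eball y (r + s).
Proof.
move=> xy z; rewrite /eball/= => zx.
have -> : z - y = (z - x) + (x - y) by rewrite addrA subrK.
exact: le_lt_trans (ler_enormD _ _) (ltr_leD zx xy).
Qed.

Lemma subset_eball x r s : r <= s -> eball x r `<=` eball x s.
Proof. by move=> rs y /lt_le_trans; apply. Qed.

End euclidean_balls.

(** * A countable base of rational cubes *)

Section rational_cubes.
Context {R : realType} {N : nat}.

(* Numbers that code no pair get the radius 0 and are discarded by the
   condition [0 < cube_radius k] wherever these cubes are used. *)
Definition cube_index (k : nat) : 'rV[rat]_N * rat := odflt (0, 0) (unpickle k).

Definition cube_center (k : nat) : 'rV[R]_N := map_mx ratr (cube_index k).1.

Definition cube_radius (k : nat) : R := ratr (cube_index k).2.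

Lemma ball_rowP (x y : 'rV[R]_N) (r : R) :
  0 < r -> ball x r y <-> forall i, `|y 0 i - x 0 i| < r.
Proof.
move=> r0; split=> [[_ xy] i|xy]; first by rewrite distrC; exact: xy.
by split=> // i j; rewrite (ord1 i) -ball_normE/= distrC; exact: xy.
Qed.

(** The closed cube is placed inside [O] because it later serves as the compact set containing the
    support of a bump function. *)
Lemma rational_cube_basis (O : set 'rV[R]_N) x : open O -> O x ->
  exists k, [/\ 0 < cube_radius k, ball (cube_center k) (cube_radius k) x &
    [set y : 'rV[R]_N | forall i, `|y 0 i - cube_center k 0 i| <= cube_radius k] `<=` O].
Proof.
move=> oO Ox; have /nbhs_ballP[e /= e0 xeO] := open_nbhs_nbhs (conj oO Ox).
(* With the centre within q of x, every point of the closed cube is within 2q < e of x. *)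
have [q] := @rat_in_itvoo R 0 (e / 2) (divr_gt0 e0 (ltr0n _ 2)).
rewrite in_itv/= => /andP[q0 qe].
have /choice[c cP] : forall i, exists c : rat, `|x 0 i - ratr c| < ratr q :> R.
  move=> i; have [|c] := @rat_in_itvoo R (x 0 i - ratr q) (x 0 i).
    by rewrite ltrBlDr ltrDl.
  rewrite in_itv/= => /andP[c1 c2]; exists c.
  by rewrite gtr0_norm ?subr_gt0// ltrBlDl -ltrBlDr.
exists (pickle (\row_i c i, q)).
rewrite /cube_radius /cube_center /cube_index pickleK/=; split=> //.
  by apply/ball_rowP => // i; rewrite !mxE.
move=> y /= yc; apply: xeO; apply/ball_rowP => // i.
have := yc i; rewrite !mxE => {}yc.
rewrite (le_lt_trans (ler_distD (ratr (c i)) _ _))//.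
by rewrite (splitr e) ltr_leD// ?(le_lt_trans yc)// distrC (le_trans (ltW (cP i)))// ltW.
Qed.

End rational_cubes.

(** * Lebesgue measure on R^N *)

Section lebesgue_measure_on_Rn.
Context {R : realType}.

Lemma borel_open N (O : set 'rV[R]_N) :
  open O -> measurable (O : set (borelRn R N)).
Proof. by move=> oO; exact: sub_sigma_algebra. Qed.

Lemma borel_continuous N (f : 'rV[R]_N -> R) :
  continuous f -> measurable_fun setT (f : borelRn R N -> R).
Proof.
move=> /continuousP cf; apply: (measurability _ (RGenOpens.measurableE R)).
move=> _ [_ [a [b ->] <-]]; rewrite setTI; apply: borel_open.
exact/cf/interval_open.
Qed.

Lemma open_bigcup_cubes N (O : set 'rV[R]_N) : open O ->
  O = \bigcup_(k in [set k | 0 < @cube_radius R N k /\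
        [set y : 'rV[R]_N | forall i, `|y 0 i - cube_center k 0 i| <= @cube_radius R N k]
          `<=` O]) ball (cube_center k) (@cube_radius R N k).
Proof.
move=> oO; apply/seteqP; split=> x.
  by move=> /(rational_cube_basis _ _ oO)[k [r0 xk kO]]; exists k.
move=> [k /= [r0 kO] /(ball_rowP _ _ _ r0) xk]; apply: kO => i /=.
exact/ltW/xk.
Qed.

Definition rowcons n (p : R * 'rV[R]_n) : 'rV[R]_n.+1 :=
  row_mx (const_mx p.1 : 'rV[R]_1) p.2.

Lemma preimage_rowcons_ball n (c : 'rV[R]_(1 + n)) (r : R) : 0 < r ->
  @rowcons n @^-1` ball c r = ball (lsubmx c 0 0) r `*` ball (rsubmx c) r.
Proof.
move=> r0; apply/seteqP; split=> -[t y] /=.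
  move/(ball_rowP _ _ _ r0) => cty; split.
    by have := cty (lshift n 0); rewrite row_mxEl !mxE distrC.
  apply/ball_rowP => // i.
  by have := cty (rshift 1 i); rewrite row_mxEr !mxE.
move=> [ct /(ball_rowP _ _ _ r0) cy]; apply/ball_rowP => // i.
case: (split_ordP i) => j ->.
  by rewrite row_mxEl mxE distrC (ord1 j); move: ct; rewrite mxE.
by rewrite row_mxEr; have := cy j; rewrite mxE.
Qed.

(** The product sigma-algebra contains the preimages of all open sets because an open set is a
    countable union of cubes, and the preimage of a cube is a rectangle. *)
Lemma measurable_rowcons n :
  measurable_fun setT (@rowcons n : measurableTypeR R * borelRn R n -> borelRn R n.+1).
Proof.
apply: (@measurability _ _ _ (borelRn R n.+1) setT _ (@open 'rV[R]_n.+1) erefl).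
move=> _ [U oU <-]; rewrite setTI (open_bigcup_cubes _ _ oU) preimage_bigcup.
apply: bigcup_measurable => k [r0 _]; rewrite preimage_rowcons_ball//.
apply: measurableX; first exact: measurable_ball.
by apply: borel_open; exact: ball_open.
Qed.

Lemma cubes_sigma_finite N (m : {measure set (borelRn R N) -> \bar R}) :
  (forall (x : 'rV[R]_N) (r : R), 0 < r -> m (ball x r) = ((r *+ 2) ^+ N)%:E) ->
  sigma_finite setT m.
Proof.
move=> mb; exists (fun k => ball (0 : 'rV[R]_N) k.+1%:R).
  apply/esym/seteqP; split=> // x _; exists (Num.truncn `|x|) => //.
  by rewrite -ball_normE/= sub0r normrN Num.Theory.truncnS_gt.
by move=> k; split; [apply: borel_open; exact: ball_open|rewrite mb// ltry].
Qed.

Lemma sigma_finite_measure_of d (T : measurableType d)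
    (m : {measure set T -> \bar R}) : sigma_finite setT m ->
  exists m' : {sigma_finite_measure set T -> \bar R}, m' = m :> (set T -> \bar R).
Proof.
move=> sf; pose H1 := isSFinite.Build _ _ _ _ (sfinite_measure_sigma_finite sf).
pose H2 := isSigmaFinite.Build _ _ _ _ sf.
by exists (HB.pack_for (SigmaFiniteMeasure.type T R) (Measure.sort m) H1 H2).
Qed.

(** By induction, [lebesgueN] is the image under [rowcons] of the product of Lebesgue measure on the
    line with the measure one dimension lower; in dimension 0 it is a Dirac mass. The value on cubes
    is carried along because it gives the sigma-finiteness that the next product requires. It also
    yields finiteness and positivity on balls. *)
Lemma lebesgueN_measure N : exists m : {sigma_finite_measure set (borelRn R N) -> \bar R},
  (m : set (borelRn R N) -> \bar R) = @lebesgueN R N /\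
  forall (x : 'rV[R]_N) (r : R), 0 < r -> m (ball x r) = ((r *+ 2) ^+ N)%:E.
Proof.
suff [m [mE mb]] : exists m : {measure set (borelRn R N) -> \bar R},
    (m : set (borelRn R N) -> \bar R) = @lebesgueN R N /\
    forall (x : 'rV[R]_N) (r : R), 0 < r -> m (ball x r) = ((r *+ 2) ^+ N)%:E.
  have [m' m'm] := sigma_finite_measure_of _ _ _ (cubes_sigma_finite _ _ mb).
  by exists m'; rewrite m'm.
elim: N => [|n [m [mE mb]]].
  exists (@dirac _ (borelRn R 0) (0 : 'rV[R]_0) R); split.
    by apply/funext => A.
  move=> x r r0; rewrite expr0 /= /dirac indicE mem_set//.
  by apply/ball_rowP => // -[].
have [m' m'm] := sigma_finite_measure_of _ _ _ (cubes_sigma_finite _ _ mb).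
pose M : {measure set (borelRn R n.+1) -> \bar R} :=
  measure_function_pushforward__canonical__measure_function_Measure
    (@lebesgue_measure R \x m')%E (measurable_rowcons n).
exists M; split.
  apply/funext => A /=; apply: eq_integral => t _ /=.
  by rewrite m'm mE xsectionE.
move=> x r r0; rewrite /M /= /pushforward (preimage_rowcons_ball _ (x : 'rV_(1 + n)))//.
rewrite product_measure1E; last 2 first.
- exact: measurable_ball.
- by apply: borel_open; exact: ball_open.
by rewrite [X in (X * _)%E]lebesgue_measure_ball ?ltW// exprS EFinM m'm mb.
Qed.

End lebesgue_measure_on_Rn.

(** * Density points and the measure-theoretic boundary *)

Section density_points.
Context {R : realType} {N : nat}.
Implicit Types (B E : set (borelRn R N)) (x y : 'rV[R]_N).

Lemma lebesgueN0 : @lebesgueN R N set0 = 0%E.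
Proof. by have [m [<- _]] := @lebesgueN_measure R N; rewrite measure0. Qed.

Lemma lebesgueN_ge0 B : (0 <= @lebesgueN R N B)%E.
Proof. by have [m [<- _]] := @lebesgueN_measure R N. Qed.

Lemma le_lebesgueN (A B : set (borelRn R N)) : measurable A -> measurable B ->
  A `<=` B -> (lebesgueN A <= lebesgueN B)%E.
Proof.
by have [m [<- _]] := @lebesgueN_measure R N => mA mB; apply: le_measure; rewrite inE.
Qed.

Lemma measurable_eball x (r : R) : measurable (eball x r : set (borelRn R N)).
Proof. by apply: borel_open; exact: open_eball. Qed.

Lemma measurable_setI_eball B x (r : R) : measurable B ->
  measurable (B `&` eball x r : set (borelRn R N)).
Proof. by move=> mB; apply: measurableI => //; exact: measurable_eball. Qed.

Lemma lebesgueN_eball_lty x (r : R) : (lebesgueN (eball x r) < +oo)%E.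
Proof.
(* Since r is arbitrary, |r| + 1 supplies a positive radius for the formula on cubes. *)
have r0 : 0 < `|r| + 1 by rewrite ltr_pwDr.
apply: (@le_lt_trans _ _ (lebesgueN (ball x (`|r| + 1)))); last first.
  by have [m [<- mb]] := @lebesgueN_measure R N; rewrite mb// ltry.
apply: le_lebesgueN; [exact: measurable_eball|by apply: borel_open; exact: ball_open|].
apply: subset_trans (eball_sub_ball _ _ r0); apply: subset_eball.
by rewrite (le_trans (ler_norm r))// lerDl.
Qed.

Lemma lebesgueN_eball_gt0 x (r : R) : 0 < r -> (0 < lebesgueN (eball x r))%E.
Proof.
move=> r0; have /nbhs_ballP[e /= e0 ex] :=
  open_nbhs_nbhs (conj (open_eball x r) (eball_center x _ r0)).
apply: (@lt_le_trans _ _ (lebesgueN (ball x e))).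
  have [m [<- mb]] := @lebesgueN_measure R N.
  by rewrite mb// lte_fin exprn_gt0// mulrn_wgt0.
apply: le_lebesgueN => //; last exact: measurable_eball.
by apply: borel_open; exact: ball_open.
Qed.

Lemma lebesgueN_setC_eball E x (r : R) : measurable E ->
  lebesgueN (~` E `&` eball x r) = (lebesgueN (eball x r) - lebesgueN (E `&` eball x r))%E.
Proof.
move=> mE; rewrite setIC -setDE; have := lebesgueN_eball_lty x r.
have [m [<- _]] := @lebesgueN_measure R N => fin.
rewrite (@measureD _ _ _ m (eball x r) E)// ?(setIC E)//; exact: measurable_eball.
Qed.

(** An open ball is the increasing union of the concentric balls of radius r - 1/(k+1), so
    continuity from below applies. *)
Lemma lebesgueN_eball_left B x (r : R) (a : \bar R) : measurable B ->
  (a < lebesgueN (B `&` eball x r))%E ->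
  exists2 s, s < r & (a < lebesgueN (B `&` eball x s))%E.
Proof.
move=> mB; have [m [<- _]] := @lebesgueN_measure R N => am.
pose F k := B `&` eball x (r - k.+1%:R^-1).
have mF k : measurable (F k : set (borelRn R N)) by exact: measurable_setI_eball.
have UF : \bigcup_k F k = B `&` eball x r.
  apply/seteqP; split=> [y [k _ [By yk]]|y [By yr]].
    by split=> //; apply: subset_eball yk; rewrite lerBlDr lerDl.
  have /ltr_add_invr[k] : enorm (y - x) < r by [].
  by move=> yk; exists k => //; split=> //; rewrite /eball/= ltrBrDr.
have ndF : nondecreasing_seq F.
  move=> i j ij; apply/subsetPset; apply: setIS; apply: subset_eball.
  by rewrite lerB// lef_pV2 ?posrE// ler_nat.
have /cvg_lim := @nondecreasing_cvg_mu _ _ _ m F mF (bigcupT_measurable _ mF) ndF.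
move=> /(_ (@ereal_hausdorff _)); rewrite UF => mlim.
have ndm : nondecreasing_seq (m \o F).
  by move=> i j ij /=; apply: le_measure; rewrite ?inE//; exact/subsetPset/ndF.
move: am; rewrite -mlim (cvg_lim _ (ereal_nondecreasing_cvgn ndm))//.
move=> /ereal_sup_gt[_ [k _ <-] ak]; exists (r - k.+1%:R^-1) => //.
by rewrite ltrBlDr ltrDl invr_gt0.
Qed.

(* The function is lower semicontinuous, by left continuity in the radius. *)
Lemma measurable_lebesgueN_eball B (r : R) : measurable B ->
  measurable_fun setT ((fun x => lebesgueN (B `&` eball x r)) : borelRn R N -> \bar R).
Proof.
move=> mB; apply: (measurability _ (ErealGenOInfty.measurableE R)).
move=> /= _ [_ [a ->]] <-; rewrite setTI; apply: borel_open.
rewrite openE => x /=; rewrite in_itv/= andbT => ax.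
have [s sr ase] := lebesgueN_eball_left _ _ _ _ mB ax.
have rs0 : 0 < r - s by rewrite subr_gt0.
apply: (filterS _ (open_nbhs_nbhs (conj (open_eball x _) (eball_center x _ rs0)))).
move=> y; rewrite /eball/= => yx; rewrite in_itv/= andbT (lt_le_trans ase)//.
apply: le_lebesgueN; [exact: measurable_setI_eball|exact: measurable_setI_eball|].
apply: setIS; rewrite -[X in _ `<=` eball _ X](subrK s) addrC.
apply: eball_shift; apply/ltW; apply: le_lt_trans yx.
by rewrite /enorm ler_wsqrtr// ler_sum// => i _; rewrite !mxE -sqrrN opprB.
Qed.

(* Left continuity in the radius allows one to test rational radii only. *)
Lemma measurable_density1 E : measurable E -> measurable (density1 E : set (borelRn R N)).
Proof.
move=> mE; pose G k (q : rat) := [set x : borelRn R N |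
  ((1 - k.+1%:R^-1)%:E * lebesgueN (eball x (ratr q))
     <= lebesgueN (E `&` eball x (ratr q)))%E].
have mG k q : measurable (G k q).
  rewrite -[G k q]setTI; apply: measurable_lee => //.
    apply: measurable_funeM; have := @measurable_lebesgueN_eball setT (ratr q) measurableT.
    by under eq_fun do rewrite setTI.
  exact: measurable_lebesgueN_eball.
suff -> : density1 E = \bigcap_k \bigcup_j \bigcap_q
    (if (0 < q) && (q < j.+1%:R^-1) then G k q else setT).
  apply: bigcapT_measurable => k; apply: bigcupT_measurable => j.
  rewrite -[X in measurable X]setCK setC_bigcap; apply: measurableC.
  by apply: bigcupT_measurable_rat => q; apply: measurableC; case: ifP.
have fin x r : (lebesgueN (E `&` eball x r) \is a fin_num).
  rewrite ge0_fin_numE ?lebesgueN_ge0//.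
  apply: le_lt_trans (lebesgueN_eball_lty x r); apply: le_lebesgueN => //.
  - exact: measurable_setI_eball.
  - exact: measurable_eball.
have finb x r : (lebesgueN (eball x r) \is a fin_num).
  by rewrite ge0_fin_numE ?lebesgueN_ge0// lebesgueN_eball_lty.
have ratioP x r e : 0 < r -> 0 < e ->
    (`|1 - fine (lebesgueN (E `&` eball x r)) / fine (lebesgueN (eball x r))| <= e) =
    ((1 - e)%:E * lebesgueN (eball x r) <= lebesgueN (E `&` eball x r))%E.
  move=> r0 e0; have b0 : 0 < fine (lebesgueN (eball x r)).
    by rewrite fine_gt0// lebesgueN_eball_gt0// lebesgueN_eball_lty.
  rewrite -[X in (_ * X <= _)%E]fineK// -[X in (_ <= X)%E]fineK// -EFinM lee_fin.
  rewrite ger0_norm; first by rewrite lerBlDr -lerBlDl ler_pdivlMr.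
  rewrite subr_ge0 ler_pdivrMr// mul1r fine_le//.
  apply: le_lebesgueN => //; [exact: measurable_setI_eball|exact: measurable_eball].
apply/seteqP; split=> x.
  rewrite /density1/= => /cvgrPdist_le cvg k _.
  have k0 : (0 : R) < k.+1%:R^-1 by rewrite invr_gt0.
  have [d /= d0 dP] := cvg _ k0.
  have /ltr_add_invr[j] := d0; rewrite add0r => jd.
  exists j => // q _; case: ifP => // /andP[q0 qj].
  have q0' : 0 < ratr q :> R by rewrite ltr0q.
  rewrite /G/= -ratioP//; apply: dP => //=.
  rewrite sub0r normrN gtr0_norm// (lt_trans _ jd)//.
  by move: qj; rewrite -(ltr_rat R) fmorphV/= ratr_nat.
move=> xG; apply/cvgrPdist_le => e e0.
have /ltr_add_invr[k] := e0; rewrite add0r => ke.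
have [j _ jP] := xG k I.
have j0 : (0 : R) < j.+1%:R^-1 by rewrite invr_gt0.
near=> s.
have s0 : 0 < s by near: s; exact: nbhs_right_gt.
have sj : s < j.+1%:R^-1 by near: s; exact: nbhs_right_lt.
rewrite (le_trans _ (ltW ke))// ratioP ?invr_gt0//.
have [k1|k1] := leP (1 - k.+1%:R^-1 : R) 0.
  apply: (@le_trans _ _ 0%E); last exact: lebesgueN_ge0.
  by rewrite mule_le0_ge0// ?lee_fin// lebesgueN_ge0.
(* If the bound failed at the real radius s, shrinking only the ball in the denominator to some s' <
   s would preserve the failure. Monotonicity of both measures then makes the bound fail at every
   rational q between s' and s, against the choice of j. *)
rewrite leNgt; apply/negP => lts.
have : (((1 - k.+1%:R^-1)^-1)%:E * lebesgueN (E `&` eball x s) < lebesgueN (setT `&` eball x s))%E.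
  by rewrite setTI muleC lte_pdivrMr// muleC.
move=> /(lebesgueN_eball_left _ _ _ _ measurableT)[s' s's]; rewrite setTI => lts'.
have [q] : exists q : rat, ratr q \in `]Num.max s' 0, s[.
  by apply: rat_in_itvoo; rewrite gt_max s's s0.
rewrite in_itv/= gt_max => /andP[/andP[s'q q0] qs].
have := jP q I; rewrite -(ltr0q R) q0/=.
have -> : q < j.+1%:R^-1.
  by rewrite -(ltr_rat R) fmorphV/= ratr_nat (lt_trans qs).
rewrite /G/=; apply/negP; rewrite -ltNge.
apply: (@le_lt_trans _ _ (lebesgueN (E `&` eball x s))).
  apply: le_lebesgueN; [exact: measurable_setI_eball|exact: measurable_setI_eball|].
  by apply: setIS; apply: subset_eball; exact: ltW.
rewrite -lte_pdivrMl//; apply: (lt_le_trans lts').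
apply: le_lebesgueN; [exact: measurable_eball|exact: measurable_eball|].
by apply: subset_eball; exact: ltW.
Unshelve. all: by end_near. Qed.

Lemma measurable_essbd E : measurable E -> measurable (essbd E : set (borelRn R N)).
Proof.
move=> mE; apply: measurableC.
by apply: measurableU; apply: measurable_density1 => //; exact: measurableC.
Qed.

(** The complement of the support of Lebesgue measure restricted to [E]. *)
Definition null_nbhd E : set 'rV[R]_N :=
  [set x | exists2 r : R, 0 < r & lebesgueN (E `&` eball x r) = 0%E].

Lemma open_null_nbhd E : measurable E -> open (null_nbhd E).
Proof.
move=> mE; rewrite openE => x [r r0 Er].
have r20 : 0 < r / 2 by rewrite divr_gt0.
apply: (filterS _ (open_nbhs_nbhs (conj (open_eball x _) (eball_center x _ r20)))).
move=> y yx; exists (r / 2) => //; apply/eqP; rewrite eq_le lebesgueN_ge0 andbT -Er.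
apply: le_lebesgueN; [exact: measurable_setI_eball|exact: measurable_setI_eball|].
apply: setIS; rewrite [X in _ `<=` eball _ X](splitr r).
apply: eball_shift; exact/ltW.
Qed.

(** Balls have finite measure, so the strict upper bound in [measbd] says exactly that the
    complement of [E] has positive measure in the ball. *)
Lemma measbdE E : measurable E -> measbd E = ~` (null_nbhd E `|` null_nbhd (~` E)).
Proof.
move=> mE; apply/seteqP; split=> x.
  move=> xE [] [r r0 Er]; have /andP := xE r r0.
    by rewrite Er ltxx => -[].
  move=> [_]; rewrite lebesgueN_setC_eball// in Er; rewrite -sube_gt0 ?Er ?ltxx//.
move=> /not_orP[xE xEC] r r0; apply/andP; split.
  rewrite lt_def lebesgueN_ge0 andbT; apply/eqP => Er; apply: xE; by exists r.
rewrite -sube_gt0 -lebesgueN_setC_eball// lt_def lebesgueN_ge0 andbT.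
by apply/eqP => Er; apply: xEC; exists r.
Qed.

Lemma null_nbhd_notin_density1 E x : measurable E -> null_nbhd E x -> ~ density1 E x.
Proof.
move=> mE [r r0 Er] xE.
suff /(cvg_unique _ xE) : (fun r : R => fine (lebesgueN (E `&` eball x r)) /
                         fine (lebesgueN (eball x r))) @ 0^'+ --> (0 : R).
  by move/(_ (@Rhausdorff _))/eqP; rewrite oner_eq0.
apply: cvg_near_cst; near=> s.
suff -> : lebesgueN (E `&` eball x s) = 0%E by rewrite mul0r.
apply/eqP; rewrite eq_le lebesgueN_ge0 andbT -Er.
apply: le_lebesgueN; [exact: measurable_setI_eball|exact: measurable_setI_eball|].
by apply: setIS; apply: subset_eball; near: s; exact: nbhs_right_ltW.
Unshelve. all: by end_near. Qed.

Lemma null_nbhd_setC_density1 E x : measurable E -> null_nbhd (~` E) x -> density1 E x.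
Proof.
move=> mE [r r0 Er]; apply: cvg_near_cst; near=> s.
have s0 : 0 < s by near: s; exact: nbhs_right_gt.
suff -> : lebesgueN (E `&` eball x s) = lebesgueN (eball x s).
  by rewrite divff// gt_eqF// fine_gt0// lebesgueN_eball_gt0// lebesgueN_eball_lty.
apply/eqP; rewrite eq_le; apply/andP; split.
  apply: le_lebesgueN => //; [exact: measurable_setI_eball|exact: measurable_eball].
rewrite -sube_le0 -lebesgueN_setC_eball// -Er.
have mCE : measurable (~` E) by exact: measurableC.
apply: le_lebesgueN; [exact: measurable_setI_eball|exact: measurable_setI_eball|].
by apply: setIS; apply: subset_eball; near: s; exact: nbhs_right_ltW.
Unshelve. all: by end_near. Qed.

Lemma null_nbhd_notin_essbd E x :
  measurable E -> null_nbhd E x \/ null_nbhd (~` E) x -> ~ essbd E x.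
Proof.
move=> mE xE; apply; case: xE => xE.
  by right; apply: null_nbhd_setC_density1; [exact: measurableC|rewrite setCK].
by left; exact: null_nbhd_setC_density1.
Qed.

Lemma setC_closure_null_nbhd E : ~` closure (E : set 'rV[R]_N) `<=` null_nbhd E.
Proof.
move=> x xE.
have /nbhs_ballP[e /= e0 xeE] : nbhs x (~` closure (E : set 'rV[R]_N)).
  by apply: open_nbhs_nbhs; split=> //; apply: closed_openC; exact: closed_closure.
exists e => //; rewrite (_ : _ `&` _ = set0) ?lebesgueN0// -subset0 => y [Ey yxe].
by have := xeE _ (eball_sub_ball _ _ e0 _ yxe); apply; exact: subset_closure.
Qed.

Lemma density1_sub_closure E : measurable E -> density1 E `<=` closure (E : set 'rV[R]_N).
Proof.
move=> mE x xE; apply: contrapT => /setC_closure_null_nbhd.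
by move/null_nbhd_notin_density1; apply.
Qed.

Lemma essbd_sub_closure E : measurable E -> essbd E `<=` closure (E : set 'rV[R]_N).
Proof.
move=> mE x xE; apply: contrapT => /setC_closure_null_nbhd xn.
by apply: null_nbhd_notin_essbd xE => //; left.
Qed.

Lemma measbd_sub_closure E : measurable E -> measbd E `<=` closure (E : set 'rV[R]_N).
Proof.
move=> mE x; rewrite measbdE// => xE; apply: contrapT => /setC_closure_null_nbhd xn.
by apply: xE; left.
Qed.

Lemma measurable_measbd E : measurable E -> measurable (measbd E : set (borelRn R N)).
Proof.
move=> mE; rewrite measbdE//; apply: measurableC.
by apply: measurableU; apply: borel_open; apply: open_null_nbhd => //; exact: measurableC.
Qed.

End density_points.

(** * Smooth functions *)

Section flat_functions.
Context {R : realType}.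

(* The functions p(1/t) exp(-1/t), extended by 0 to t <= 0, form a class closed
   under differentiation, because (p(1/t))' = - p'(1/t) / t^2. *)
Definition flat (p : {poly R}) (t : R) : R :=
  if t <= 0 then 0 else p.[t^-1] * expR (- t^-1).

Lemma flat_le0 p t : t <= 0 -> flat p t = 0.
Proof. by rewrite /flat => ->. Qed.

Lemma flat1_gt0 t : 0 < t -> 0 < flat 1 t.
Proof. by move=> t0; rewrite /flat leNgt t0/= hornerE mul1r expR_gt0. Qed.

Lemma flat1_ge0 t : 0 <= flat 1 t.
Proof. by rewrite /flat; case: ifP => // _; rewrite hornerE mul1r expR_ge0. Qed.

Lemma exprn_le_expR n (u : R) : 0 <= u -> u ^+ n.+1 <= (n.+1)`!%:R * expR u.
Proof.
move=> u0; rewrite mulrC -ler_pdivrMr ?ltr0n ?fact_gt0//.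
by apply: le_trans (expR_ge1Dxn n u0); rewrite lerDr.
Qed.

Lemma horner_le_exprn (q : {poly R}) : exists2 C, 0 <= C &
  forall u : R, 1 <= u -> `|q.[u]| <= C * u ^+ size q.
Proof.
exists (\sum_(i < size q) `|q`_i|); first by apply: sumr_ge0 => i _.
move=> u u1; rewrite horner_coef mulr_suml.
apply: le_trans (ler_norm_sum _ _ _) _; apply: ler_sum => i _.
rewrite normrM ler_wpM2l// normrX ger0_norm ?(le_trans ler01)//.
by rewrite ler_weXn2l// ltnW.
Qed.

(** This bounds the difference quotient of [flat p] at 0. With u = 1/h the claim becomes u^2 |p(u)|
    <= K exp(u), which holds because the exponential dominates every power. *)
Lemma flat_small (p : {poly R}) : exists2 K, 0 <= K &
  forall h : R, `|h| <= 1 -> `|h^-1 * flat p h| <= K * `|h|.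
Proof.
have [C C0 CP] := horner_le_exprn p.
(* The degree bound [size p] plus two: one power of 1/h from the quotient, one from the factor |h|
   on the right. *)
pose m := (size p).+2.
exists (C * m`!%:R); first by rewrite mulr_ge0.
move=> h h1; have [h0|h0] := leP h 0.
  by rewrite flat_le0// mulr0 normr0 !mulr_ge0.
rewrite gtr0_norm// in h1.
have u1 : 1 <= h^-1 by rewrite invf_ge1.
rewrite /flat [h <= 0]leNgt h0/= !normrM (gtr0_norm (expR_gt0 _)) normfV (gtr0_norm h0).
rewrite mulrA expRN ler_pdivrMr ?expR_gt0// mulrAC -ler_pdivrMr//.
rewrite mulrAC ?invrK.
apply: (@le_trans _ _ (C * h^-1 ^+ m)).
  rewrite /m !exprS !mulrA -(mulrA C) [X in _ <= X]mulrC mulrA mulrC.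
  rewrite [X in _ <= X](_ : _ = h^-1 * (h^-1 * (C * h^-1 ^+ size p))); last by ring.
  by rewrite mulrA ler_pM2l ?CP// mulr_gt0 ?invr_gt0.
have := exprn_le_expR (size p).+1 _ (ltW (lt_le_trans ltr01 u1)).
by rewrite -mulrA; apply: ler_wpM2l.
Qed.

(** For t > 0 the product rule differentiates 1/t in both factors, which produces the common factor
    1/t^2, that is 'X^2 evaluated at 1/t. For t = 0 the derivative is 0 by [flat_small]. *)
Lemma is_derive_flat (p : {poly R}) (t : R) :
  is_derive t (1 : R) (flat p) (flat ('X^2 * (p - p^`())) t).
Proof.
have [t0|t0|->] := ltgtP t 0.
- rewrite flat_le0 ?ltW//.
  apply: (@near_eq_is_derive _ _ _ (cst 0)).
  by near=> s; rewrite flat_le0// ltW//; near: s; exact: lt_nbhsl.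
- pose g (s : R) := p.[s^-1] * expR (- s^-1).
  apply: (@near_eq_is_derive _ _ _ g).
    near=> s; rewrite /flat leNgt ifF//; apply/negbTE; rewrite negbK.
    by near: s; exact: lt_nbhsr.
  have tn0 : t != 0 by rewrite gt_eqF.
  have dV : is_derive t 1 (fun s : R => s^-1) (- t ^- 2).
    apply: DeriveDef; first exact: derivableV.
    by rewrite deriveV// derive_id /GRing.scale/= mulr1.
  have d1 : is_derive t 1 (horner p \o (fun s : R => s^-1)) (p^`().[t^-1] * - t ^- 2).
    exact: is_derive1_comp.
  have d2 : is_derive t 1 (expR \o (fun s : R => - s^-1)) (expR (- t^-1) * (t ^- 2)).
    apply: is_derive1_comp.
    by rewrite -[t ^- 2]opprK; exact: is_deriveN.
  rewrite /flat [t <= 0]leNgt t0/= !hornerE.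
  have /is_derive_eq := is_deriveM d1 d2; apply.
  by rewrite /GRing.scale/= -exprVn; ring.
- have [K K0 KP] := flat_small p.
  have lim0 : (fun h : R => h^-1 *: (flat p (h *: 1 + 0) - flat p 0)) @ 0^' --> (0 : R).
    apply/cvgrPdist_le => e e0; near=> h.
    rewrite addr0 [h *: 1]mulr1 (flat_le0 _ 0)// subr0 sub0r normrN /GRing.scale/=.
    apply: (@le_trans _ _ (K * `|h|)).
      by apply: KP; near: h; apply: dnbhs0_le.
    apply: (@le_trans _ _ ((K + 1) * `|h|)); first by rewrite ler_wpM2r// lerDl.
    rewrite mulrC -ler_pdivlMr ?ltr_wpDl//; near: h; apply: dnbhs0_le.
    by rewrite divr_gt0// ltr_wpDl.
  rewrite flat_le0//; apply: DeriveDef; first by apply/cvg_ex; exists 0.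
  exact: cvg_lim lim0.
Unshelve. all: by end_near. Qed.

End flat_functions.

Section smooth_functions.
Context {R : realType} {N : nat}.
Implicit Types f g : 'rV[R]_N -> R.

(* This class is closed under partial derivatives, so that all its elements are
   C^oo without any formula for iterated derivatives. *)
Inductive smooth_expr : ('rV[R]_N -> R) -> Prop :=
| smooth_cst c : smooth_expr (cst c)
| smooth_coord i : smooth_expr (fun x => x 0 i)
| smooth_add f g : smooth_expr f -> smooth_expr g -> smooth_expr (fun x => f x + g x)
| smooth_mul f g : smooth_expr f -> smooth_expr g -> smooth_expr (fun x => f x * g x)
| smooth_inv f : smooth_expr f -> (forall x, f x != 0) -> smooth_expr (fun x => (f x)^-1)
| smooth_flat p f : smooth_expr f -> smooth_expr (fun x => flat p (f x)).

Lemma smooth_expr_continuous f : smooth_expr f -> continuous f.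
Proof.
elim=> {f} [c|i|f g _ cf _ cg|f g _ cf _ cg|f _ cf f0|p f _ cf] x.
- exact: cst_continuous.
- exact: coord_continuous.
- by apply: continuousD; [exact: cf|exact: cg].
- by apply: continuousM; [exact: cf|exact: cg].
- by apply: continuousV => //; exact: cf.
- apply: (@continuous_comp _ _ _ f (flat p)); first exact: cf.
  apply/differentiable_continuous/derivable1_diffP.
  by have [] := is_derive_flat p (f x).
Qed.

(** Restriction to a line makes the one-variable chain rule available for directional
    derivatives. *)
Lemma is_derive_line f (x v : 'rV[R]_N) (df : R) :
  is_derive x v f df <-> is_derive (0 : R) 1 (fun h : R => f (h *: v + x)) df.
Proof.
suff E : 'D_v f x = 'D_1 (fun h : R => f (h *: v + x)) 0.
  have [D1 D2] := derivable1P f x v; split=> -[fx <-].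
    by apply: (DeriveDef (D1 fx)).
  by apply: (DeriveDef (D2 fx)).
rewrite /derive; set g := fun h : R => f (h *: v + x).
rewrite (_ : (fun h : R => h^-1 *: ((g \o shift 0) (h *: 1) - g 0)) =
  (fun h => h^-1 *: ((f \o shift x) (h *: v) - f x)))//.
by apply/funext => h; rewrite /g/= addr0 scale0r add0r [h *: 1]mulr1.
Qed.

Lemma is_derive_comp_line f (g : R -> R) (x v : 'rV[R]_N) (df dg : R) :
  is_derive x v f df -> is_derive (f x) 1 g dg -> is_derive x v (g \o f) (dg * df).
Proof.
move=> /is_derive_line fx gx; apply/is_derive_line.
by apply: (@is_derive1_comp _ g (fun h => f (h *: v + x))) => //; rewrite scale0r add0r.
Qed.

Lemma smooth_expr_partial f (i : 'I_N) : smooth_expr f ->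
  exists2 g, smooth_expr g & forall x, is_derive x (delta_mx 0 i) f (g x).
Proof.
elim=> {f} [c|j|f g sf [df sdf fP] sg [dg sdg gP]|f g sf [df sdf fP] sg [dg sdg gP]|
  f sf [df sdf fP] f0|p f sf [df sdf fP]].
- by exists (cst 0); [exact: smooth_cst|move=> x; exact: is_derive_cst].
- exists (cst ((delta_mx 0 i : 'rV[R]_N) 0 j)); first exact: smooth_cst.
  move=> x; apply/is_derive_line.
  rewrite (_ : (fun h : R => _) =
    (fun h => h * (delta_mx 0 i : 'rV[R]_N) 0 j + x 0 j)).
    by apply: is_derive_eq => /=; rewrite !scaler0 addr0 add0r [_ *: 1]mulr1.
  by apply/funext => h; rewrite !mxE.
- by exists (fun x => df x + dg x); [exact: smooth_add|move=> x; exact: is_deriveD].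
- exists (fun x => f x * dg x + g x * df x).
    by apply: smooth_add; exact: smooth_mul.
  by move=> x; apply: is_deriveM.
- exists (fun x => (-1) * (((f x)^-1 * (f x)^-1) * df x)).
    apply: smooth_mul; first exact: smooth_cst.
    by apply: smooth_mul => //; apply: smooth_mul; exact: smooth_inv.
  move=> x; have [fx fxE] := fP x.
  apply: DeriveDef; first exact: derivableV.
  by rewrite deriveV// fxE /GRing.scale/= mulN1r mulNr -exprVn expr2.
- exists (fun x => flat ('X^2 * (p - p^`())) (f x) * df x).
    by apply: smooth_mul => //; exact: smooth_flat.
  by move=> x; apply: is_derive_comp_line => //; exact: is_derive_flat.
Qed.

Lemma smooth_expr_smooth f : smooth_expr f -> smooth f.
Proof.
move=> sf s; suff sg : smooth_expr (foldr (@partial R N) f s).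
  split; first exact: smooth_expr_continuous.
  by move=> x i; have [g _ /(_ x)[]] := smooth_expr_partial _ i sg.
elim: s => //= i s /(smooth_expr_partial _ i)[g sg gP].
by rewrite (_ : partial i _ = g)//; apply/funext => x; have [] := gP x.
Qed.

Lemma smooth_prod (I : Type) (r : seq I) (F : I -> 'rV[R]_N -> R) :
  (forall i, smooth_expr (F i)) -> smooth_expr (fun x => \prod_(i <- r) F i x).
Proof.
move=> sF; elim: r => [|i r IH].
  by under eq_fun do rewrite big_nil; exact: smooth_cst.
by under eq_fun do rewrite big_cons; exact: smooth_mul.
Qed.

(** A product of the classical bumps exp(-1/(r^2 - s^2)), one for each coordinate. *)
Definition cube_bump (c : 'rV[R]_N) (r : R) (x : 'rV[R]_N) : R :=
  \prod_(i < N) flat 1 (r ^+ 2 - (x 0 i - c 0 i) ^+ 2).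

Lemma smooth_cube_bump c r : smooth_expr (cube_bump c r).
Proof.
apply: smooth_prod => i; apply: smooth_flat.
have sx : smooth_expr (fun x => x 0 i + cst (- c 0 i) x).
  by apply: smooth_add; [exact: smooth_coord|exact: smooth_cst].
have s2 := smooth_mul _ _ (smooth_cst (- 1)) (smooth_mul _ _ sx sx).
by under eq_fun do rewrite -mulN1r; exact: smooth_add (smooth_cst _) s2.
Qed.

Lemma cube_bump_ge0 c r x : 0 <= cube_bump c r x.
Proof. by apply: prodr_ge0 => i _; exact: flat1_ge0. Qed.

Lemma cube_bump_gt0 c r x : 0 < r ->
  0 < cube_bump c r x <-> forall i, `|x 0 i - c 0 i| < r.
Proof.
move=> r0; have sqP i : (0 < r ^+ 2 - (x 0 i - c 0 i) ^+ 2) = (`|x 0 i - c 0 i| < r).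
  by rewrite subr_gt0 -[ltLHS]real_normK ?num_real// ltr_pXn2r// nnegrE// ltW.
split=> [bx i|xr]; last by apply: prodr_gt0 => i _; rewrite flat1_gt0// sqP.
rewrite -sqP ltNge; apply/negP => le0; move: bx.
by rewrite /cube_bump (bigD1 i)//= flat_le0// mul0r ltxx.
Qed.

End smooth_functions.

(** * Radon measures and their Jordan decomposition *)

Section radon_measures.
Context {R : realType} {N : nat}.
Variable Om : set 'rV[R]_N.
Implicit Types (A B F K : set (borelRn R N)) (nu : set 'rV[R]_N -> R).
Implicit Types c : {charge set (borelRn R N) -> \bar R}.

Lemma cin_subset (A B : set 'rV[R]_N) : A `<=` B -> cin B Om -> cin A Om.
Proof.
move=> /closureS AB [bB BO]; split; last exact: subset_trans BO.
by apply: (filterS (F := pinfty_nbhs R)) bB => M bB x Ax; apply: bB; exact: AB.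
Qed.

Lemma cin_sub_closure (A B : set 'rV[R]_N) : A `<=` closure B -> cin B Om -> cin A Om.
Proof.
move=> AB cB; apply: (cin_subset _ _ AB).
by move: cB; rewrite /cin -(closure_id (closure B)).1//; exact: closed_closure.
Qed.

Lemma cinU (A B : set 'rV[R]_N) : cin A Om -> cin B Om -> cin (A `|` B) Om.
Proof.
move=> [bA AO] [bB BO]; rewrite /cin closureU; split; last by rewrite subUset.
apply: (filterS (F := pinfty_nbhs R)) (@filterI _ (pinfty_nbhs R) _ _ _ bA bB).
by move=> M [hA hB] x []; [exact: hA|exact: hB].
Qed.

Lemma cin0 : cin (set0 : set 'rV[R]_N) Om.
Proof. by rewrite /cin closure0; split=> //; apply: (filterE (F := pinfty_nbhs R)) => M x. Qed.

(** Additivity along the constant sequence of empty sets makes n nu(∅) converge, so its constant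
    increment nu(∅) must be 0. *)
Lemma Mloc0 nu : Mloc Om (nu : set 'rV[R]_N -> R^o) -> nu set0 = 0.
Proof.
move=> /(_ (fun=> set0)); rewrite bigcup0// => nu0.
have {}nu0 : (fun n : nat => nu set0 *+ n) @ \oo --> (nu set0 : R).
  have := nu0 (fun=> measurable0) (@trivIset_set0 _ _ _) cin0.
  by under eq_fun do rewrite sumr_const card_ord.
have : (fun n : nat => nu set0 *+ n.+1 - nu set0 *+ n) @ \oo --> nu set0 - nu set0.
  apply: cvgB => //.
  by have := nu0; rewrite -(@cvg_shiftS _ (fun n : nat => nu set0 *+ n)).
under eq_fun do rewrite mulrSr addrAC subrr add0r.
by rewrite subrr => /(cvg_unique _ (cvg_cst _)); apply.
Qed.

Lemma MlocN nu : Mloc Om (nu : set 'rV[R]_N -> R^o) ->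
  Mloc Om ((fun B => - nu B) : set 'rV[R]_N -> R^o).
Proof.
move=> Mnu F mF tF cF; under eq_fun do rewrite sumrN.
by apply: cvgN; exact: Mnu.
Qed.

(** Restriction to a fixed [K] ⋐ [Om] turns a locally finite set function into a genuine charge, to
    which the Hahn decomposition applies. *)
Lemma Mloc_charge nu K : Mloc Om (nu : set 'rV[R]_N -> R^o) ->
  measurable K -> cin K Om ->
  exists c, forall B, c B = (nu (B `&` K))%:E.
Proof.
move=> Mnu mK cK; pose c0 (B : set (borelRn R N)) := (nu (B `&` K))%:E.
have c00 : c0 set0 = 0%E by rewrite /c0 set0I Mloc0.
have cfin x : measurable x -> c0 x \is a fin_num by [].
have csig : semi_sigma_additive c0.
  move=> F mF tF mUF; rewrite /c0 setI_bigcupl.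
  under eq_fun do rewrite big_mkord sumEFin.
  apply: cvg_EFin; first by near=> n.
  apply: Mnu.
  - by move=> k; exact: measurableI.
  - exact: trivIset_setIr.
  - by apply: cin_subset cK; apply: bigcup_sub => k _; exact: subIsetr.
pose H := isCharge.Build _ _ _ c0 c00 cfin csig.
pose c : {charge set (borelRn R N) -> \bar R} := HB.pack c0 H.
by exists c.
Unshelve. all: by end_near. Qed.

Lemma MlocU nu A B : Mloc Om (nu : set 'rV[R]_N -> R^o) ->
  measurable A -> measurable B -> cin (A `|` B) Om -> A `&` B = set0 ->
  nu (A `|` B) = nu A + nu B.
Proof.
move=> Mnu mA mB cAB AB0.
have [c cE] := Mloc_charge _ _ Mnu (measurableU _ _ mA mB) cAB.
have := chargeU c mA mB AB0; rewrite !cE setIid => -[->].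
by rewrite !setIUr !setIid (setIC B) AB0 setU0 set0U.
Qed.

Lemma posvar_ub nu A F : measurable F -> F `<=` A -> cin F Om ->
  ((nu F)%:E <= posvar Om nu A)%E.
Proof. by move=> mF FA cF; apply: ereal_sup_ubound; exists F. Qed.

Lemma posvar_le nu A (x : \bar R) :
  (forall F, measurable F -> F `<=` A -> cin F Om -> ((nu F)%:E <= x)%E) ->
  (posvar Om nu A <= x)%E.
Proof. by move=> Fx; apply: ge_ereal_sup => _ [F [mF FA cF] <-]; exact: Fx. Qed.

(** The union of competitors for [A] and [B] is a competitor for the union. Subtraction of the other
    term, legitimate once everything is finite, lets each supremum be taken in turn. *)
Lemma posvar_superadd nu A B : Mloc Om (nu : set 'rV[R]_N -> R^o) ->
  A `&` B = set0 -> (posvar Om nu A + posvar Om nu B <= posvar Om nu (A `|` B))%E.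
Proof.
move=> Mnu AB0.
have pos X : (0 <= posvar Om nu X)%E.
  by have := @posvar_ub nu X set0 measurable0 (@sub0set _ _) cin0; rewrite Mloc0.
have mono X : X `<=` A `|` B -> (posvar Om nu X <= posvar Om nu (A `|` B))%E.
  by move=> XAB; apply: posvar_le => F mF FX cF; apply: posvar_ub => //; exact: subset_trans XAB.
have [->|fin] := eqVneq (posvar Om nu (A `|` B)) +oo%E; first exact: leey.
have finX X : X `<=` A `|` B -> posvar Om nu X \is a fin_num.
  by move=> /mono le; rewrite ge0_fin_numE// (le_lt_trans le)// ltey.
have finA : posvar Om nu A \is a fin_num by apply: finX; exact: subsetUl.
rewrite addeC -leeBrDr//; apply: posvar_le => G mG GB cG.
rewrite leeBrDr// addeC -leeBrDr//; apply: posvar_le => F mF FA cF.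
rewrite leeBrDr// -EFinD -MlocU//.
- by apply: posvar_ub; [exact: measurableU|exact: setUSS|exact: cinU].
- exact: cinU.
- by rewrite -subset0 -AB0 => x [/FA Ax /GB Bx].
Qed.

(** For countable additivity, one inequality cuts a competitor along the pieces and uses the
    additivity of [nu]; the other is finite superadditivity passed to the limit. No Hahn set for the
    whole of [Om] is required, so infinite values are harmless. *)
Lemma posvar_measure nu : Mloc Om (nu : set 'rV[R]_N -> R^o) ->
  exists P : {measure set (borelRn R N) -> \bar R},
    P = posvar Om nu :> (set (borelRn R N) -> \bar R).
Proof.
move=> Mnu.
have pos X : (0 <= posvar Om nu X)%E.
  by have := @posvar_ub nu X set0 measurable0 (@sub0set _ _) cin0; rewrite Mloc0.
have p0 : posvar Om nu set0 = 0%E.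
  apply/eqP; rewrite eq_le pos andbT; apply: posvar_le => F _.
  by rewrite subset0 => -> _; rewrite Mloc0.
have psig : semi_sigma_additive (posvar Om nu).
  move=> F mF tF mUF.
  have cvF : cvgn (fun n => \sum_(0 <= i < n) posvar Om nu (F i))%E.
    by apply: is_cvg_nneseries.
  suff -> : posvar Om nu (\bigcup_k F k) = (\sum_(0 <= i <oo) posvar Om nu (F i))%E.
    exact: cvF.
  apply/eqP; rewrite eq_le; apply/andP; split.
    apply: posvar_le => G mG GF cG.
    have GE : \bigcup_k (G `&` F k) = G by rewrite -setI_bigcupr; exact/setIidPl.
    have mGF k : measurable (G `&` F k) by exact: measurableI.
    have tGF : trivIset setT (fun k => G `&` F k) by exact: trivIset_setIl.
    have := Mnu _ mGF tGF; rewrite GE => /(_ cG) cvG.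
    have {cvG} : EFin \o (fun n => \sum_(k < n) nu (G `&` F k)) @ \oo --> (nu G)%:E.
      by apply: cvg_EFin => //; near=> n.
    move/cvge_to_le; apply; near=> n => /=.
    rewrite -sumEFin (le_trans _ (nneseries_lim_ge n _))//.
    rewrite big_mkord; apply: lee_sum => k _; apply: posvar_ub => //.
    by apply: cin_subset cG; exact: subIsetl.
  apply: lime_le => //; near=> n.
  apply: (@le_trans _ _ (posvar Om nu (\bigcup_(k < n) F k))); last first.
    apply: posvar_le => G mG GF cG; apply: posvar_ub => //.
    by apply: subset_trans GF _ => x [k _ Fx]; exists k.
  elim: (n) => [|m IH]; first by rewrite big_geq.
  rewrite big_nat_recr//= bigcup_mkord big_ord_recr/= -bigcup_mkord.
  apply: le_trans (posvar_superadd _ _ _ Mnu _); first by rewrite leeD2r.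
  rewrite setI_bigcupl; apply: bigcup0 => k /= km.
  by move/trivIsetP : tF => /(_ k m I I); apply; rewrite ltn_eqF.
pose H := isMeasure.Build _ _ _ (posvar Om nu) p0 pos psig.
pose P : {measure set (borelRn R N) -> \bar R} := HB.pack (posvar Om nu) H.
by exists P.
Unshelve. all: by end_near. Qed.

Lemma Hahn_le c P M F : hahn_decomposition c P M -> measurable F -> (c F <= c P)%E.
Proof.
move=> [[mP posP] [mM negM] PM PM0] mF.
rewrite (charge_partition _ mF mP mM PM PM0) (chargeDI c mP mF) setIC addeC.
apply: leeD => //; apply: (@le_trans _ _ 0%E).
  by apply: negM; [exact: measurableI|exact: subIsetr].
by apply: posP; [exact: measurableD|exact: subDsetl].
Qed.

(** The supremum is attained at the part of [K] in the positive Hahn set. *)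
Lemma posvar_Hahn nu K c P M : measurable K -> cin K Om ->
  (forall B, c B = (nu (B `&` K))%:E) -> hahn_decomposition c P M ->
  posvar Om nu K = c P.
Proof.
move=> mK cK cE PM; apply/eqP; rewrite eq_le; apply/andP; split.
  apply: posvar_le => F mF FK cF; rewrite -[F](setIidl FK) -cE.
  exact: Hahn_le PM mF.
have [[mP _] _ _ _] := PM.
rewrite cE; apply: posvar_ub; first exact: measurableI.
  exact: subIsetr.
by apply: cin_subset cK; exact: subIsetr.
Qed.

Lemma hahn_copp c P M : hahn_decomposition c P M -> hahn_decomposition (copp c) M P.
Proof.
move=> [[mP posP] [mM negM] PM PM0]; split; rewrite 1?setUC 1?setIC//.
  by split=> // A mA AM; rewrite /= /copp oppe_ge0; exact: negM.
by split=> // A mA AP; rewrite /= /copp oppe_le0; exact: posP.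
Qed.

(** For the charge restricted to [K] with Hahn sets P and M, the two variations of [K] are c(P) and
    -c(M). Both are finite, and their difference is the total charge. *)
Lemma Jordan nu K : Mloc Om (nu : set 'rV[R]_N -> R^o) -> measurable K -> cin K Om ->
  [/\ (posvar Om nu K < +oo)%E, (negvar Om nu K < +oo)%E &
   nu K = fine (posvar Om nu K) - fine (negvar Om nu K)].
Proof.
move=> Mnu mK cK; have [c cE] := Mloc_charge _ _ Mnu mK cK.
have [P [M PM]] := Hahn_decomposition c.
have [[mP _] [mM _] PMT PM0] := PM.
rewrite (posvar_Hahn _ _ _ _ _ mK cK cE PM).
have cNE B : copp c B = (- nu (B `&` K))%:E by rewrite /= /copp cE.
rewrite /negvar (posvar_Hahn _ _ _ _ _ mK cK cNE (hahn_copp _ _ _ PM)) /= /copp.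
split; [by rewrite cE ltry|by rewrite cE ltry|].
have := chargeU c mP mM PM0.
by rewrite PMT !cE/= setTI => -[->]; rewrite opprK.
Qed.

Lemma Mloc_of_charge c : Mloc Om ((fun B => fine (c B)) : set 'rV[R]_N -> R^o).
Proof.
move=> F mF tF _.
have mUF : measurable (\bigcup_k F k) by exact: bigcupT_measurable.
have := @charge_semi_sigma_additive _ _ _ c F mF tF mUF.
rewrite -[X in _ --> X]fineK ?fin_num_measure// => /fine_cvgP[_].
rewrite (_ : fine \o _ = (fun n : nat => \sum_(k < n) fine (c (F k))))//.
apply/funext => n /=; rewrite big_mkord sum_fine//= => k _.
by rewrite fin_num_measure.
Qed.

Lemma posvar_charge_lty c : (posvar Om (fun B => fine (c B)) setT < +oo)%E.
Proof.
have [P [M PM]] := Hahn_decomposition c; have [[mP _] _ _ _] := PM.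
apply: (@le_lt_trans _ _ (c P)); last by rewrite ltey_eq fin_num_measure.
apply: posvar_le => F mF _ _; rewrite fineK ?fin_num_measure//.
exact: Hahn_le PM mF.
Qed.

End radon_measures.

(** * Measures annihilating test functions *)

Section vanishing.
Context {R : realType} {N : nat}.
Implicit Types (O V : set 'rV[R]_N) (phi : 'rV[R]_N -> R).

(** The support is controlled by some compact set rather than by its closure, so that sums and
    saturations inherit the control at once. *)
Definition bump V phi : Prop :=
  [/\ smooth_expr phi, forall x, 0 <= phi x &
      exists2 K, compact K /\ K `<=` V & forall x, phi x != 0 -> K x].

Lemma smooth_testfun V phi K : smooth_expr phi -> compact K -> K `<=` V ->
  (forall x, phi x != 0 -> K x) -> testfun V phi.
Proof.
move=> sphi cK KV phiK.
have clK : closed K by apply: compact_closed => //; exact: norm_hausdorff.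
have supK : closure [set x | phi x != 0] `<=` K.
  by rewrite [X in _ `<=` X](closure_id K).1//; exact: closureS.
split; [exact: smooth_expr_smooth| |exact: subset_trans KV].
exact: (subclosed_compact (@closed_closure _ _) cK supK).
Qed.

Lemma compact_cube (c : 'rV[R]_N) (r : R) :
  compact [set y : 'rV[R]_N | forall i, `|y 0 i - c 0 i| <= r].
Proof.
have := @rV_compact R N (fun i => `[c 0 i - r, c 0 i + r]%classic)
  (fun i => @segment_compact _ _ _).
congr compact; apply/seteqP; split=> y /= yc i; have := yc i;
  by rewrite /= in_itv/= ler_distl.
Qed.

Lemma bump0 V : bump V (cst 0).
Proof.
split=> //; [exact: smooth_cst|exists set0; last by move=> x; rewrite eqxx].
by split; [exact: compact0|].
Qed.

Lemma bumpD V phi psi : bump V phi -> bump V psi -> bump V (fun x => phi x + psi x).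
Proof.
move=> [sp p0 [K [cK KV] pK]] [sq q0 [L [cL LV] qL]]; split.
- exact: smooth_add.
- by move=> x; rewrite addr_ge0.
- exists (K `|` L); first by split; [exact: compactU|rewrite subUset].
  move=> x; have [->|/pK Kx] := eqVneq (phi x) 0; last by left.
  by rewrite add0r => /qL; right.
Qed.

(** Partial sums of the bumps on the rational cubes inside [O]; finite sums suffice, so no series of
    smooth functions has to be differentiated. *)
Lemma bump_exhaustion O : open O -> exists S : nat -> 'rV[R]_N -> R,
  [/\ forall n, bump O (S n), forall x m n, (m <= n)%N -> S m x <= S n x &
      forall x, O x -> exists n, 0 < S n x].
Proof.
move=> oO.
pose good k := `[< 0 < @cube_radius R N k /\
  [set y : 'rV[R]_N | forall i, `|y 0 i - cube_center k 0 i| <= @cube_radius R N k]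
    `<=` O >].
pose b k : 'rV[R]_N -> R :=
  if good k then cube_bump (cube_center k) (@cube_radius R N k) else cst 0.
have bb k : bump O (b k).
  rewrite /b; case: ifPn => [/asboolP[r0 kO]|_]; last exact: bump0.
  split; [exact: smooth_cube_bump|exact: cube_bump_ge0|].
  exists [set y : 'rV[R]_N | forall i, `|y 0 i - cube_center k 0 i| <= @cube_radius R N k].
    by split; [exact: compact_cube|exact: kO].
  move=> x bx i; apply/ltW; move: i; apply/cube_bump_gt0 => //.
  by rewrite lt_def bx cube_bump_ge0.
have b0 k x : 0 <= b k x by have [] := bb k.
exists (fun n x => \sum_(k < n) b k x); split.
- elim=> [|n IH].
    by under eq_fun do rewrite big_ord0; exact: bump0.
  by under eq_fun do rewrite big_ord_recr; exact: bumpD.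
- move=> x m n mn; rewrite -!(big_mkord predT (fun k => b k x)) (big_cat_nat _ mn)//=.
  by rewrite lerDl sumr_ge0.
- move=> x Ox; have [k [r0 xk kO]] := rational_cube_basis _ _ oO Ox.
  exists k.+1; rewrite big_ord_recr/= ltr_wpDl ?sumr_ge0//.
  rewrite /b ifT; last exact/asboolP.
  by apply/cube_bump_gt0 => //; exact/ball_rowP.
Qed.

(* These test functions increase to the indicator function of [0 < phi], with
   the same support as [phi]. *)
Definition saturate phi (k : nat) (x : 'rV[R]_N) : R :=
  (k%:R * phi x) * (1 + k%:R * phi x)^-1.

Lemma saturate_den_gt0 phi k x : 0 <= phi x -> 0 < 1 + k%:R * phi x.
Proof. by move=> p0; rewrite ltr_wpDr// mulr_ge0. Qed.

Lemma saturate_bump W phi k : bump W phi -> bump W (saturate phi k).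
Proof.
move=> [sp p0 [K cK pK]].
have skp : smooth_expr (fun x => cst k%:R x * phi x).
  by apply: smooth_mul => //; exact: smooth_cst.
split.
- apply: smooth_mul => //.
  apply: (@smooth_inv _ _ (fun x => 1 + k%:R * phi x)).
    by apply: smooth_add => //; exact: smooth_cst.
  by move=> x; rewrite gt_eqF// saturate_den_gt0.
- move=> x; rewrite /saturate mulr_ge0 ?mulr_ge0// invr_ge0 ltW//.
  exact: saturate_den_gt0.
- exists K => // x sx; apply: pK; apply: contra_neq sx => px.
  by rewrite /saturate px mulr0 mul0r.
Qed.

Lemma saturate_le1 phi k x : 0 <= phi x -> saturate phi k x <= 1.
Proof.
move=> p0; rewrite /saturate ler_pdivrMr ?saturate_den_gt0// mul1r.
by rewrite lerDr.
Qed.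

Lemma saturate_nd phi x : 0 <= phi x -> {homo (saturate phi)^~ x : m n / (m <= n)%N >-> m <= n}.
Proof.
move=> p0 m n mn; rewrite /saturate.
rewrite ler_pdivrMr ?saturate_den_gt0// mulrAC ler_pdivlMr ?saturate_den_gt0//.
rewrite !mulrDr !mulr1 (mulrC (n%:R * _) (m%:R * _)) lerD2r.
by rewrite ler_wpM2r// ler_nat.
Qed.

Lemma saturate_cvg phi x : 0 <= phi x ->
  saturate phi k x @[k --> \oo] --> (\1_[set y | 0 < phi y] x : R).
Proof.
move=> p0; rewrite indicE; have [px|px] := ltP 0 (phi x); last first.
  rewrite memNset/=; last by apply/negP; rewrite -leNgt.
  have -> : (saturate phi)^~ x = cst 0.
    have px0 : phi x = 0 by apply/eqP; rewrite eq_le px p0.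
    by apply/funext => k; rewrite /saturate px0 mulr0 mul0r.
  exact: cvg_cst.
rewrite mem_set//=; apply/cvgrPdist_le => e e0; near=> k.
have k0 : 0 < 1 + k%:R * phi x by exact: saturate_den_gt0.
have -> : 1 - saturate phi k x = (1 + k%:R * phi x)^-1.
  rewrite /saturate -[X in X - _](@divff _ (1 + k%:R * phi x)) ?gt_eqF//.
  by rewrite -mulrBl addrK mul1r.
rewrite gtr0_norm ?invr_gt0// -[e]invrK lef_pV2 ?posrE ?invr_gt0//.
rewrite (@le_trans _ _ (k%:R * phi x))// ?lerDr//.
rewrite -ler_pdivrMr//; near: k; exact: nbhs_infty_ger.
Unshelve. all: by end_near. Qed.

Variables (Om V : set 'rV[R]_N) (c : {charge set (borelRn R N) -> \bar R}).
Hypotheses (oOm : open Om) (oV : open V) (VOm : V `<=` Om).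
Let nu (B : set 'rV[R]_N) : R := fine (c B).
Hypothesis nu0 : forall phi, testfun V phi -> sint Om nu Om phi = 0.

Lemma negvar_copp : negvar Om nu = posvar Om (fun B => fine (copp c B)).
Proof. by rewrite /negvar; congr posvar; apply/funext => B; rewrite /= /copp fineN. Qed.

Let mOm : measurable (Om : set (borelRn R N)). Proof. exact: borel_open. Qed.

Lemma integral_saturate_cvg (P : {measure set (borelRn R N) -> \bar R}) phi :
  bump Om phi ->
  (\int[P]_(x in (Om : set (borelRn R N))) (saturate phi k x)%:E)%E @[k --> \oo]
    --> P [set x | 0 < phi x].
Proof.
move=> bp; have [sp p0 [K [cK KOm] pK]] := bp.
have cphi : continuous phi by exact: smooth_expr_continuous.
have osupp : open [set x | 0 < phi x].
  by apply: (@open_comp _ _ phi [set t : R | 0 < t]); [move=> x _; exact: cphi|exact: open_gt].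
have mcvg := @cvg_monotone_convergence _ (borelRn R N) R P Om mOm
   (fun k x => (saturate phi k x)%:E).
have : (\int[P]_(x in (Om : set (borelRn R N))) limn (fun k => (saturate phi k x)%:E))%E
    = P [set x | 0 < phi x].
  rewrite (eq_integral (fun x : borelRn R N =>
      (\1_([set y | 0 < phi y] : set (borelRn R N)) x)%:E)).
    rewrite integral_indic//; last exact: borel_open.
    by congr (P _); apply/setIidl => x /= px; apply/KOm/pK; rewrite gt_eqF.
  move=> x _; apply/cvg_lim => //; apply: cvg_EFin; first by near=> k.
  exact: saturate_cvg.
move=> <-; apply: mcvg.
- move=> k; apply/measurable_EFinP; apply: measurable_funTS; apply: borel_continuous.
  by apply: smooth_expr_continuous; have [] := saturate_bump _ _ k bp.
- by move=> k x _; rewrite lee_fin; have [_ + _] := saturate_bump _ _ k bp; exact.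
- by move=> x _ m n mn; rewrite lee_fin; exact: saturate_nd.
Unshelve. all: by end_near. Qed.

(* The two variations agree on the sets [0 < phi], hence on open sets, which are
   increasing unions of such sets, hence on all Borel subsets of [V]. *)
Lemma vanishing_on_subsets (P M : {measure set (borelRn R N) -> \bar R}) :
  P = posvar Om nu :> (set _ -> _) -> M = negvar Om nu :> (set _ -> _) ->
  forall B : set (borelRn R N), measurable B -> B `<=` V -> P B = M B.
Proof.
move=> PE ME.
have finP B : measurable B -> P B \is a fin_num.
  move=> mB; rewrite ge0_fin_numE//; apply: (@le_lt_trans _ _ (P setT)).
    by apply: le_measure; rewrite ?inE.
  by rewrite PE; exact: posvar_charge_lty.
have finM B : measurable B -> M B \is a fin_num.
  move=> mB; rewrite ge0_fin_numE//; apply: (@le_lt_trans _ _ (M setT)).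
    by apply: le_measure; rewrite ?inE.
  by rewrite ME negvar_copp; exact: posvar_charge_lty.
have step1 phi : bump V phi -> P [set x | 0 < phi x] = M [set x | 0 < phi x].
  move=> bp; have bOm : bump Om phi.
    case: bp => sp p0 [K [cK KV] pK]; split=> //; exists K => //; split=> //.
    exact: subset_trans VOm.
  (* [sint] applies [fine] to both integrals, so a zero difference gives equal integrals only once
     both are known to be finite. *)
  have finI (Q : {measure set (borelRn R N) -> \bar R}) k :
      Q (Om : set (borelRn R N)) \is a fin_num ->
      (\int[Q]_(x in (Om : set (borelRn R N))) (saturate phi k x)%:E)%E \is a fin_num.
    move=> finQ; have [sk k0 _] := saturate_bump _ _ k bp.
    rewrite ge0_fin_numE; last by apply: integral_ge0 => x _; rewrite lee_fin.
    apply: (@le_lt_trans _ _ (\int[Q]_(x in (Om : set (borelRn R N))) (cst 1%E x))%E).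
      apply: ge0_le_integral => //.
      - by move=> x _; rewrite lee_fin.
      - apply/measurable_EFinP; apply: measurable_funTS; apply: borel_continuous.
        exact: smooth_expr_continuous.
      - by move=> x _; rewrite lee_fin saturate_le1//; have [_ + _] := bp; exact.
    by rewrite integral_cst// mul1e ltey_eq finQ.
  have eqI k : (\int[P]_(x in (Om : set (borelRn R N))) (saturate phi k x)%:E =
      \int[M]_(x in (Om : set (borelRn R N))) (saturate phi k x)%:E)%E.
    rewrite -[LHS]fineK ?finI ?finP// -[RHS]fineK ?finI ?finM//.
    congr EFin; apply/eqP; rewrite -subr_eq0 PE ME.
    have [sk k0 [K [cK KV] kK]] := saturate_bump _ _ k bp.
    exact/eqP/(nu0 _ (smooth_testfun _ _ _ sk cK KV kK)).
  have := integral_saturate_cvg M _ bOm; have := integral_saturate_cvg P _ bOm.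
  under eq_fun do rewrite eqI.
  by move=> /cvg_unique; apply.
have step2 (O : set 'rV[R]_N) : open O -> O `<=` V -> P O = M O.
  move=> oO OV; have [S [bS Sle SO]] := bump_exhaustion _ oO.
  have OE : O = \bigcup_n [set x | 0 < S n x].
    apply/seteqP; split=> x; first by move=> /SO[n]; exists n.
    case=> n _ /= Sx; have [_ _ [K [_ KO] SK]] := bS n.
    by apply/KO/SK; rewrite gt_eqF.
  have mS n : measurable ([set x | 0 < S n x] : set (borelRn R N)).
    have [sS _ _] := bS n; apply: borel_open.
    apply: (@open_comp _ _ (S n) [set t : R | 0 < t]); last exact: open_gt.
    by move=> x _; exact: smooth_expr_continuous.
  have ndS : nondecreasing_seq (fun n => [set x | 0 < S n x] : set (borelRn R N)).
    by move=> m n mn; apply/subsetPset => x /= /lt_le_trans; apply; exact: Sle.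
  have mU : measurable (\bigcup_n ([set x | 0 < S n x] : set (borelRn R N))).
    exact: bigcupT_measurable.
  have := nondecreasing_cvg_mu (mu := P) mS mU ndS.
  have := nondecreasing_cvg_mu (mu := M) mS mU ndS.
  rewrite -OE; have -> : M \o (fun n => [set x | 0 < S n x]) = P \o (fun n => [set x | 0 < S n x]).
    apply/funext => n /=; apply/esym/step1.
    have [sS S0 [K [cK KO] SK]] := bS n; split=> //; exists K => //; split=> //.
    exact: subset_trans OV.
  by move=> cM cP; apply: cvg_unique cP cM.
have mV : measurable (V : set (borelRn R N)) by exact: borel_open.
move=> B mB BV; rewrite -(setIidl BV).
(* Open sets are stable under intersection and generate the Borel sets, and the measures restricted
   to [V] are finite, so the whole space alone is an exhausting sequence. *)
apply: (@measure_unique _ R (borelRn R N) (@open 'rV[R]_N) (fun=> setT) erefl _ _ _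
   (mrestr P mV) (mrestr M mV)) => //.
- by move=> X Y; exact: openI.
- by move=> _; exact: openT.
- by rewrite bigcup_const//; exists 0%N.
- by move=> O oO; apply: step2; [exact: openI|exact: subIsetr].
- by move=> k; rewrite /= /mrestr setTI ltey_eq finP.
Qed.

(** Equality of the variations gives nu(F) = 0 for each Borel F ⊂ V with F ⋐ Om by [Jordan]; both
    variations of [V] are suprema of such values up to sign. *)
Lemma vanishing : posvar Om nu V = 0%E /\ negvar Om nu V = 0%E.
Proof.
have Mnu : Mloc Om (nu : set 'rV[R]_N -> R^o) := Mloc_of_charge Om c.
have [P PE] := posvar_measure _ _ Mnu.
have [M ME] := posvar_measure _ _ (MlocN _ _ Mnu).
have PM := vanishing_on_subsets P M PE ME.
have nuF (F : set (borelRn R N)) : measurable F -> F `<=` V -> cin F Om -> nu F = 0.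
  move=> mF FV cF; have [_ _ ->] := Jordan _ _ _ Mnu mF cF.
  by rewrite -PE /negvar -ME PM// subrr.
split; apply/eqP; rewrite eq_le; apply/andP; split.
- by apply: posvar_le => F mF FV cF; rewrite nuF.
- by rewrite -PE.
- by apply: posvar_le => F mF FV cF; rewrite nuF// oppr0.
- by rewrite /negvar -ME.
Qed.

End vanishing.

(** * Cutoff functions and the pairing *)

Section cutoff.
Context {R : realType} {N : nat}.
Implicit Types (K V : set 'rV[R]_N) (phi : 'rV[R]_N -> R).

Lemma partial_near phi (i : 'I_N) x (a : R) :
  (\forall y \near x, phi y = a) -> partial i phi x = 0.
Proof.
move=> phia; rewrite /partial (@near_eq_derive _ _ _ phi (cst a))//.
exact: derive_cst.
Qed.

Lemma testfun_eq0 V phi x : testfun V phi -> ~ V x -> phi x = 0.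
Proof.
move=> [_ _ sV] nVx; apply/eqP; apply: contrapT => /negP px.
by apply: nVx; apply: sV; exact: subset_closure.
Qed.

Lemma testfun_partial_eq0 V phi (i : 'I_N) x :
  testfun V phi -> ~ V x -> partial i phi x = 0.
Proof.
move=> [_ _ sV] nVx; apply: (@partial_near _ _ _ 0).
have : nbhs x (~` closure [set y | phi y != 0]).
  apply: open_nbhs_nbhs; split; last by move=> /sV.
  by apply: closed_openC; exact: closed_closure.
apply: filterS => y cy; apply/eqP; apply: contrapT => /negP py.
by apply: cy; exact: subset_closure.
Qed.

Lemma testfunS V W phi : V `<=` W -> testfun V phi -> testfun W phi.
Proof. by move=> VW [sphi cphi sV]; split=> //; exact: subset_trans VW. Qed.

(** Compactness, together with the monotonicity of the exhausting sequence, lets a single index n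
    serve on all of [K]; the threshold 1/(n+1) shrinks with the same index. *)
Lemma bump_pos_compact K V : compact K -> open V -> K `<=` V ->
  exists Phi d, [/\ bump V Phi, 0 < d & forall x, K x -> d < Phi x].
Proof.
move=> cK oV KV; have [S [bS Sle SV]] := bump_exhaustion _ oV.
have cS n : continuous (S n) by have [/smooth_expr_continuous + _ _] := bS n.
have /compact_near_coveringP cover := cK.
have [|n _ /(_ n (leqnn n)) KS] :=
    cover nat (nbhs \oo) (fun n x => n.+1%:R^-1 < S n x) _.
  move=> x /KV/SV[m Sm0].
  have e0 : 0 < S m x / 2 by rewrite divr_gt0.
  have cSm : S m y @[y --> x] --> S m x by exact: cS.
  have Smx : S m x / 2 < S m x by rewrite ltr_pdivrMr// ltr_pMr// ltr1n.
  exists ([set y | S m x / 2 < S m y],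
      [set n | (m <= n)%N /\ n.+1%:R^-1 < S m x / 2]).
    split; first exact: (cvgr_gt _ cSm _ Smx).
    have /ltr_add_invr[k] := e0; rewrite add0r => ke.
    exists (maxn m k) => // n /=; rewrite geq_max => /andP[mn kn]; split=> //.
    by apply: le_lt_trans ke; rewrite lef_pV2 ?posrE// ler_nat.
  move=> [y n] /= [Smy [mn ne]].
  exact: lt_le_trans (lt_trans ne Smy) (Sle _ _ _ mn).
by exists (S n), n.+1%:R^-1; split=> //; rewrite invr_gt0.
Qed.

(** The quotient a/(a+b), where a > 0 exactly for Phi > d/2 and b > 0 exactly for Phi < d, so that
    the denominator never vanishes. It equals 1 on the open set Phi > d, which contains [K], and 0
    wherever Phi = 0. *)
Lemma cutoff_exists K V : compact K -> open V -> K `<=` V ->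
  exists phi, [/\ testfun V phi, forall x, 0 <= phi x &
    forall x, K x -> \forall y \near x, phi y = 1].
Proof.
move=> cK oV KV; have [Phi [d [bPhi d0 Phid]]] := bump_pos_compact _ _ cK oV KV.
have [sPhi Phi0 [L [cL LV] PhiL]] := bPhi.
pose a (x : 'rV[R]_N) := flat 1 (Phi x + cst (- (d / 2)) x).
pose b (x : 'rV[R]_N) := flat 1 (cst d x + cst (-1) x * Phi x).
have sa : smooth_expr a.
  by apply: smooth_flat; apply: smooth_add => //; exact: smooth_cst.
have sb : smooth_expr b.
  apply: smooth_flat; apply: smooth_add; first exact: smooth_cst.
  by apply: smooth_mul => //; exact: smooth_cst.
have ab0 x : 0 < a x + b x.
  have [le|gt] := leP (Phi x) (d / 2).
    rewrite ltr_wpDl ?flat1_ge0// flat1_gt0//= mulN1r subr_gt0 (le_lt_trans le)//.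
    by rewrite ltr_pdivrMr// ltr_pMr// ltr1n.
  by rewrite ltr_wpDr ?flat1_ge0// flat1_gt0//= subr_gt0.
exists (fun x => a x * (a x + b x)^-1); split.
- apply: (@smooth_testfun _ _ _ _ L) => //.
    apply: smooth_mul => //; apply: (@smooth_inv _ _ (fun x => a x + b x)).
      exact: smooth_add.
    by move=> x; rewrite gt_eqF.
  move=> x abx; apply: PhiL; apply: contra_neq abx => Phix.
  by rewrite /a /= Phix add0r flat_le0 ?mul0r// oppr_le0 divr_ge0// ltW.
- by move=> x; rewrite mulr_ge0 ?flat1_ge0// invr_ge0 ltW.
- move=> x Kx; have : \forall y \near x, d < Phi y.
    have cPhi : Phi y @[y --> x] --> Phi x by exact: smooth_expr_continuous.
    exact: (cvgr_gt _ cPhi _ (Phid _ Kx)).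
  apply: filterS => y Phiy.
  have -> : b y = 0 by rewrite /b flat_le0//= mulN1r subr_le0 ltW.
  rewrite addr0 divff// gt_eqF//; move: (ab0 y).
  by rewrite /b flat_le0 ?addr0//= mulN1r subr_le0 ltW.
Qed.

End cutoff.

(** * Integrals against signed Radon measures *)

Section signed_integrals.
Context {R : realType} {N : nat}.
Variable Om : set 'rV[R]_N.
Implicit Types (D K : set (borelRn R N)) (nu : set 'rV[R]_N -> R).

Lemma sint_eq0 nu D (f : 'rV[R]_N -> R) : Mloc Om (nu : set 'rV[R]_N -> R^o) ->
  (forall x, f x = 0) -> sint Om nu D f = 0.
Proof.
move=> Mnu f0; rewrite /sint /negvar.
have [P <-] := posvar_measure _ _ Mnu.
have [M <-] := posvar_measure _ _ (MlocN _ _ Mnu).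
by rewrite !integral0_eq ?subrr// => x _; rewrite f0.
Qed.

Lemma sint_cst1 nu K : Mloc Om (nu : set 'rV[R]_N -> R^o) ->
  measurable K -> cin K Om -> sint Om nu K (cst 1) = nu K.
Proof.
move=> Mnu mK cK; have [_ _ ->] := Jordan _ _ _ Mnu mK cK.
rewrite /sint /negvar; have [P <-] := posvar_measure _ _ Mnu.
have [M <-] := posvar_measure _ _ (MlocN _ _ Mnu).
have I (Q : {measure set (borelRn R N) -> \bar R}) :
    (\int[Q]_(x in K) (cst 1 x : R)%:E = Q K)%E.
  by rewrite (eq_integral (cst 1%E))// integral_cst// mul1e.
by rewrite !I.
Qed.

Lemma Mloc_coord (A : set 'rV[R]_N -> 'rV[R]_N) (i : 'I_N) : Mloc Om A ->
  Mloc Om ((fun B => A B 0 i) : set 'rV[R]_N -> R^o).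
Proof.
move=> MA F mF tF cF.
have := cvg_comp _ _ (MA F mF tF cF) (@coord_continuous R 1 N 0 i (A (\bigcup_k F k))).
rewrite (_ : _ \o _ = (fun n : nat => \sum_(k < n) A (F k) 0 i))//.
by apply/funext => n /=; rewrite summxE.
Qed.

Lemma grad_int_eq0 (A : set 'rV[R]_N -> 'rV[R]_N) (h phi : 'rV[R]_N -> R) : Mloc Om A ->
  (forall i x, h x * partial i phi x = 0) -> grad_int Om A h phi = 0.
Proof.
move=> MA hphi; rewrite /grad_int big1// => i _.
by apply: sint_eq0; [exact: Mloc_coord|exact: hphi].
Qed.

End signed_integrals.

(** * The support of the pairing and the divergence formula *)

Section pairing_support.
Context {R : realType} {N : nat}.
Variables (Om : set 'rV[R]_N) (oOm : open Om) (A : set 'rV[R]_N -> 'rV[R]_N).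
Variables (divA : set 'rV[R]_N -> R) (MA : Mloc Om A) (divAP : is_divergence Om A divA).
Variables (E : set (borelRn R N)) (mE : measurable E) (EOm : cin E Om).

Lemma chirep_null lam x : null_nbhd E x -> chirep lam E x = 0.
Proof.
move=> xE; rewrite /chirep !indicE !memNset ?mulr0 ?addr0//.
  by apply: null_nbhd_notin_essbd => //; left.
exact: null_nbhd_notin_density1.
Qed.

Lemma chirep_full lam x : null_nbhd (~` E) x -> chirep lam E x = 1.
Proof.
move=> xE; rewrite /chirep !indicE [x \in essbd E]memNset ?mulr0 ?addr0//.
  by rewrite mem_set//; exact: null_nbhd_setC_density1.
by apply: null_nbhd_notin_essbd => //; right.
Qed.

Lemma chirep_out lam x : ~ closure (E : set 'rV[R]_N) x -> chirep lam E x = 0.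
Proof. by move=> /setC_closure_null_nbhd; exact: chirep_null. Qed.

Lemma pairing_null lam phi : testfun (null_nbhd E) phi -> pairing Om A divA lam E phi = 0.
Proof.
move=> tphi; rewrite /pairing sint_eq0 ?grad_int_eq0 ?oppr0 ?addr0//.
- move=> i x; have [xE|xE] := pselect (null_nbhd E x).
    by rewrite chirep_null// mul0r.
  by rewrite (testfun_partial_eq0 _ _ _ _ tphi xE) mulr0.
- exact: divAP.1.
- move=> x; have [xE|xE] := pselect (null_nbhd E x).
    by rewrite chirep_null// mul0r.
  by rewrite (testfun_eq0 _ _ _ tphi xE) mulr0.
Qed.

Lemma pairing_full lam phi : testfun (null_nbhd (~` E)) phi -> testfun Om phi ->
  pairing Om A divA lam E phi = 0.
Proof.
move=> tphi tOm; rewrite /pairing.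
have -> : (fun x => chirep lam E x * phi x) = phi.
  apply/funext => x; have [xE|xE] := pselect (null_nbhd (~` E) x).
    by rewrite chirep_full// mul1r.
  by rewrite (testfun_eq0 _ _ _ tphi xE) mulr0.
rewrite (divAP.2 _ tOm) opprK; apply/eqP; rewrite subr_eq0; apply/eqP.
apply: eq_bigr => i _; congr sint; apply/funext => x.
have [xE|xE] := pselect (null_nbhd (~` E) x).
  by rewrite chirep_full.
by rewrite (testfun_partial_eq0 _ _ _ _ tphi xE) !mulr0.
Qed.

Variables (lam : borelRn R N -> R) (mu : {charge set (borelRn R N) -> \bar R}).
Hypothesis muP : represents Om mu (pairing Om A divA lam E).

Let nu (B : set 'rV[R]_N) : R := fine (mu B).

Let vanish V : open V -> V `<=` null_nbhd E \/ V `<=` null_nbhd (~` E) ->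
  posvar Om nu (V `&` Om) = 0%E /\ negvar Om nu (V `&` Om) = 0%E.
Proof.
move=> oV VE; apply: vanishing => //; first exact: openI.
move=> phi tphi; rewrite -muP; last by apply: testfunS tphi; exact: subIsetr.
have tV : testfun V phi by apply: testfunS tphi; exact: subIsetl.
case: VE => VE.
  by apply: pairing_null; exact: testfunS tV.
by apply: pairing_full; [exact: testfunS tV|apply: testfunS tphi; exact: subIsetr].
Qed.

Lemma vanishing_off_measbd :
  posvar Om nu (Om `\` measbd E) = 0%E /\ negvar Om nu (Om `\` measbd E) = 0%E.
Proof.
have Mnu : Mloc Om (nu : set 'rV[R]_N -> R^o) := Mloc_of_charge Om mu.
have mCE : measurable (~` E) by exact: measurableC.
have [p0 n0] := vanish _ (open_null_nbhd _ mE) (or_introl (@subset_refl _ _)).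
have [p1 n1] := vanish _ (open_null_nbhd _ mCE) (or_intror (@subset_refl _ _)).
have DE : Om `\` measbd E = (null_nbhd E `&` Om) `|` (null_nbhd (~` E) `&` Om).
  by rewrite measbdE// setDE setCK setIC setIUl.
have m0 B : measurable B -> measurable (null_nbhd B `&` Om : set (borelRn R N)).
  by move=> mB; apply: borel_open; apply: openI => //; exact: open_null_nbhd.
rewrite DE; move: p0 n0 p1 n1; rewrite /negvar.
have [P <-] := posvar_measure _ _ Mnu.
have [M <-] := posvar_measure _ _ (MlocN _ _ Mnu).
move=> p0 n0 p1 n1; split; rewrite measureU0//; exact: m0.
Qed.

Let cutoff := cutoff_exists (closure (E : set 'rV[R]_N)) Om
  (bounded_closed_compact EOm.1 (@closed_closure _ _)) oOm EOm.2.

Lemma sint_cutoff phi : testfun Om phi -> (forall x, 0 <= phi x) ->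
  (forall x, measbd E x -> phi x = 1) -> sint Om nu Om phi = nu (measbd E).
Proof.
move=> tphi phi0 phi1; have Mnu : Mloc Om (nu : set 'rV[R]_N -> R^o) := Mloc_of_charge Om mu.
have mbd := measurable_measbd _ mE.
have bdE := measbd_sub_closure _ mE.
have bdOm : measbd E `<=` Om := subset_trans bdE EOm.2.
have [_ _ ->] := Jordan _ _ _ Mnu mbd (cin_sub_closure _ _ _ bdE EOm).
have mOm : measurable (Om : set (borelRn R N)) by exact: borel_open.
have cphi : continuous phi by have [/(_ [::])[]] := tphi.
have := vanishing_off_measbd.
have intE (P : {measure set (borelRn R N) -> \bar R}) : P (Om `\` measbd E) = 0%E ->
    (\int[P]_(x in (Om : set (borelRn R N))) (phi x)%:E = P (measbd E))%E.
  move=> P0; rewrite (@ge0_negligible_integral _ _ _ P Om (Om `\` measbd E))//.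
  - rewrite setDD (setIidr bdOm) (eq_integral (cst 1%E)) ?integral_cst ?mul1e//.
    by move=> x; rewrite inE => /phi1 ->.
  - exact: measurableD.
  - by apply/measurable_EFinP; apply: measurable_funTS; exact: borel_continuous.
  - by move=> x _; rewrite lee_fin.
rewrite /sint /negvar.
have [P <-] := posvar_measure _ _ Mnu.
have [M <-] := posvar_measure _ _ (MlocN _ _ Mnu).
by move=> [/intE -> /intE ->].
Qed.

(** [Om] splits into E^1, ∂^*E and a remainder where the representative is 0. The first two lie in
    the closure of [E], where the variations are finite, so [fine] is additive even if div A has
    infinite variation on [Om]. *)
Lemma sint_chirep : measurable_fun (Om : set (borelRn R N)) lam ->
  (forall x, Om x -> 0 <= lam x <= 1) ->
  sint Om divA Om (chirep lam E) = divA (density1 E) + sint Om divA (essbd E) lam.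
Proof.
move=> mlam lam01; have MdA : Mloc Om (divA : set 'rV[R]_N -> R^o) := divAP.1.
have mOm : measurable (Om : set (borelRn R N)) by exact: borel_open.
have md := measurable_density1 _ mE; have me := measurable_essbd _ mE.
have dE := density1_sub_closure _ mE; have eE := essbd_sub_closure _ mE.
have dOm := subset_trans dE EOm.2; have eOm := subset_trans eE EOm.2.
have [Pd Md ->] := Jordan _ _ _ MdA md (cin_sub_closure _ _ _ dE EOm).
have [Pe Me _] := Jordan _ _ _ MdA me (cin_sub_closure _ _ _ eE EOm).
have de0 x : density1 E x -> essbd E x -> False by move=> dx; apply; left.
have mchi : measurable_fun (Om : set (borelRn R N)) (EFin \o (chirep lam E : borelRn R N -> R)).
  apply/measurable_EFinP; apply: measurable_funD; first exact: measurable_indic.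
  by apply: measurable_funM => //; exact: measurable_indic.
have chi0 x : Om x -> (0 <= (chirep lam E x)%:E)%E.
  move=> /lam01/andP[l0 _]; rewrite lee_fin /chirep addr_ge0 ?mulr_ge0//.
have intE (P : {measure set (borelRn R N) -> \bar R}) : (P (density1 E) < +oo)%E ->
    (P (essbd E) < +oo)%E ->
    fine (\int[P]_(x in (Om : set (borelRn R N))) (chirep lam E x)%:E)%E =
    fine (P (density1 E)) + fine (\int[P]_(x in (essbd E : set (borelRn R N))) (lam x)%:E)%E.
  move=> Pdoo Peoo.
  have UE : (Om : set (borelRn R N)) =
      density1 E `|` (essbd E `|` (Om `\` (density1 E `|` essbd E))).
    rewrite setUA; apply/esym/setDUK; rewrite subUset; split=> //.
  have mde := measurableU _ _ md me.
  have mR := measurableD mOm mde.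
  have meR := measurableU _ _ me mR.
  rewrite [X in integral _ X]UE ge0_integral_setU//; last 3 first.
  - by rewrite -UE.
  - by rewrite -UE.
  - apply/disj_setPS => x [dx [/(de0 _ dx)//|[_ nx]]]; apply: nx; by left.
  rewrite (ge0_integral_setU _ me mR); last 3 first.
  - by apply: measurable_funS mchi => //; rewrite [X in _ `<=` X]UE; exact: subsetUr.
  - by move=> x ex; apply: chi0; rewrite UE; right.
  - by apply/disj_setPS => x [ex [_ nx]]; apply: nx; right.
  rewrite [X in (_ + (_ + X))%E](_ : _ = 0%E) ?adde0; last first.
    apply: integral0_eq => x [_ /not_orP[nd ne]].
    by rewrite /chirep !indicE !memNset// mulr0 addr0.
  rewrite (eq_integral (cst 1%E)); last first.
    move=> x; rewrite inE => dx; rewrite /chirep !indicE (mem_set dx) memNset ?mulr0 ?addr0//.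
    by move/(de0 _ dx).
  rewrite integral_cst// mul1e.
  rewrite (eq_integral (fun x => (lam x)%:E)); last first.
    move=> x; rewrite inE => ex; rewrite /chirep !indicE (mem_set ex) memNset ?mulr1 ?add0r//.
    by move=> dx; exact: de0 dx ex.
  rewrite fineD//.
    by rewrite ge0_fin_numE.
  rewrite ge0_fin_numE; last first.
    by apply: integral_ge0 => x /eOm/lam01/andP[l0 _]; rewrite lee_fin.
  apply: le_lt_trans Peoo; rewrite -[X in (_ <= X)%E]mul1e -integral_cst//.
  apply: ge0_le_integral => //.
  - by move=> x /eOm/lam01/andP[l0 _]; rewrite lee_fin.
  - by apply/measurable_EFinP; exact: measurable_funS mlam.
  - by move=> x /eOm/lam01/andP[_ l1]; rewrite lee_fin.
move: Pd Md Pe Me; rewrite /sint /negvar.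
have [P <-] := posvar_measure _ _ MdA.
have [M <-] := posvar_measure _ _ (MlocN _ _ MdA).
by move=> Pd Md Pe Me; rewrite !intE//; ring.
Qed.

Lemma divergence_formula : measurable_fun (Om : set (borelRn R N)) lam ->
  (forall x, Om x -> 0 <= lam x <= 1) ->
  divA (density1 E) + sint Om divA (essbd E) lam = - fine (mu (measbd E)).
Proof.
move=> mlam lam01; have [phi [tphi phi0 phi1]] := cutoff.
have phiE x : closure (E : set 'rV[R]_N) x -> phi x = 1.
  by move=> /phi1/nbhs_singleton.
rewrite -/(nu (measbd E)) -(sint_cutoff _ tphi phi0); last first.
  by move=> x /(measbd_sub_closure _ mE)/phiE.
(* The gradient term is zero pointwise: phi is locally constant at each point of the closure of [E],
   and the representative vanishes elsewhere. *)
rewrite -(muP _ tphi) /pairing grad_int_eq0//; last first.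
  move=> i x; have [xE|xE] := pselect (closure (E : set 'rV[R]_N) x).
    by rewrite (partial_near _ _ _ _ (phi1 _ xE)) mulr0.
  by rewrite chirep_out// mul0r.
rewrite subr0 opprK -sint_chirep//; congr sint.
apply/funext => x; have [xE|xE] := pselect (closure (E : set 'rV[R]_N) x).
  by rewrite phiE// mulr1.
by rewrite chirep_out// mul0r.
Qed.

End pairing_support.

Theorem theorem8p1 (R : realType) (N : nat) (hN : (0 < N)%N)
    (Om : set 'rV[R]_N) (hOm : open Om) (hOm0 : Om !=set0)
    (A : set 'rV[R]_N -> 'rV[R]_N) (hA : DMloc Om A)
    (divA : set 'rV[R]_N -> R) (hdivA : is_divergence Om A divA)
    (E : set (borelRn R N)) (hE : measurable E) (hEOm : cin E Om) :
  [/\ forall lam : borelRn R N -> R,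
        measurable_fun (Om : set (borelRn R N)) lam ->
        (forall x, Om x -> 0 <= lam x <= 1) ->
        BVlam Om A divA lam E ->
        forall mu, represents Om mu (pairing Om A divA lam E) ->
        divA (density1 E) + sint Om divA (essbd E) lam =
          - fine (mu (measbd E)),
      BVlam Om A divA (cst 0) E ->
        forall mu, represents Om mu (pairing Om A divA (cst 0) E) ->
        divA (density1 E) = - fine (mu (measbd E)) &
      BVlam Om A divA (cst 1) E ->
        forall mu, represents Om mu (pairing Om A divA (cst 1) E) ->
        divA (density1 E `|` essbd E) = - fine (mu (measbd E))].
Proof.
have [MA _] := hA; have MdA := hdivA.1.
have formula := fun lam mu muP =>
  @divergence_formula R N Om hOm A divA MA hdivA E hE hEOm lam mu muP.
split.
- by move=> lam mlam lam01 _ mu muP; exact: formula.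
- move=> _ mu muP; rewrite -(formula (cst 0) mu muP)//; last by move=> x _; rewrite lexx ler01.
  by rewrite [X in _ + X]sint_eq0 ?addr0.
- move=> _ mu muP; rewrite -(formula (cst 1) mu muP)//; last by move=> x _; rewrite lexx ler01.
  have md := measurable_density1 _ hE; have me := measurable_essbd _ hE.
  have dE := density1_sub_closure _ hE; have eE := essbd_sub_closure _ hE.
  (* For lambda = 1 the integral is the mass of ∂^*E, which is disjoint from E^1, so additivity
     joins the two terms. *)
  rewrite sint_cst1//; last exact: cin_sub_closure eE hEOm.
  apply: (MlocU _ _ _ _ MdA) => //.
    by apply: cin_sub_closure hEOm; rewrite subUset.
  by rewrite -subset0 => x [dx]; apply; left.
Qed.
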